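(* For every $p\in(1,2]$ there exist a constant $c_p\in(0,2)$ and sequences $\eta_n\to0$, $\eta'_n\to0$ (depending only on $p$) such that for every $n\in\mathbb{N}$ and every $\mathbf{k}$ as below there exists $$\alpha=(1+\eta_n)\frac{\log(2/c_p)\cdot n}{2^n}\quad\text{with}\quad f_{p,\mathbf{k},n}(\alpha)\ge-(1+\eta'_n)\log(2/c_p)\cdot n.$$
   Context: $\log$ is the natural logarithm. $\mathbf{k}=(k_1,\dots,k_{m+1})$ integers with $0=k_1<\cdots<k_{m+1}=n$. For $\mathbf{x}\in\mathbb{R}^n$ put $\mathbf{x}_j=(x_{k_j+1},\dots,x_{k_{j+1}})$, $\|\mathbf{x}\|_{p,\mathbf{k},n}=(\sum_{j=1}^m\|\mathbf{x}_j\|_2^p)^{1/p}$ ($\|\cdot\|_2$ Euclidean norm), $d(\mathbf{x},\mathbf{y})=\|\mathbf{y}-\mathbf{x}\|_{p,\mathbf{k},n}$, $B(\mathbf{x},r)=\{\mathbf{y}:d(\mathbf{x},\mathbf{y})\le r\}$, and $r_n$ is the radius with $\mathrm{vol}(B(\mathbf 0,r_n))=1$. For bounded measurable $S\subseteq\mathbb{R}^n$ and integer $t\ge1$ let $\hat Z_S(t)=\frac1{t!}\int_{S^t}\mathbf 1[d(\mathbf{x}_i,\mathbf{x}_j)\ge2r_n\ \forall i\ne j]\,d\mathbf{x}_1\cdots d\mathbf{x}_t$, $\hat Z_S(0)=1$. With $V=V(R)=\mathrm{vol}(B(\mathbf 0,R))=(R/r_n)^n$, the entropy density is $$f_{p,\mathbf{k},n}(\alpha)=\lim_{R\to\infty}\frac{1}{\alpha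 V}\log\frac{\hat Z_{B(\mathbf 0,R)}(\lfloor\alpha V\rfloor)}{V^{\lfloor\alpha V\rfloor}/\lfloor\alpha V\rfloor!}$$ (interpreted as $\liminf$ if the limit does not exist, with the convention $\log0=-\infty$). *)

(* Defs.v *)
From mathcomp Require Import all_boot all_order all_algebra.
From mathcomp Require Import all_classical all_reals all_analysis.

Set Implicit Arguments.
Unset Strict Implicit.
Unset Printing Implicit Defensive.

Import Order.TTheory GRing.Theory Num.Theory.
Local Open Scope classical_set_scope.
Local Open Scope ring_scope.

Section Defs.
Variable R : realType.

Definition cbox (I : finType) (a b : I -> R) : set (I -> R) :=
  [set x | forall i, a i <= x i <= b i].

Definition cbox_vol (I : finType) (a b : I -> R) : R :=
  \prod_(i : I) Num.max 0 (b i - a i).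

Definition vol (I : finType) (S : set (I -> R)) : \bar R :=
  ereal_inf [set (\sum_(0 <= j <oo) (cbox_vol (ab.1 j) (ab.2 j))%:E)%E
            | ab in [set ab : (nat -> I -> R) * (nat -> I -> R) |
                     S `<=` \bigcup_j cbox (ab.1 j) (ab.2 j)]].

(* Euclidean norm of the j-th block x_j = (x_{k_j+1},...,x_{k_{j+1}}) (1-based),
   i.e. coordinates k j <= i < k (j+1) in 0-based indexing, where the paper's
   k_1,...,k_{m+1} is k 0, ..., k m here. *)
Definition block_norm (n : nat) (k : nat -> nat) (x : 'I_n -> R) (j : nat) : R :=
  Num.sqrt (\sum_(i < n | (k j <= i < k j.+1)%N) x i ^+ 2).

Definition pk_norm (p : R) (n m : nat) (k : nat -> nat) (x : 'I_n -> R) : R :=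
  powR (\sum_(j < m) powR (block_norm k x j) p) p^-1.

Definition pk_dist (p : R) (n m : nat) (k : nat -> nat) (x y : 'I_n -> R) : R :=
  pk_norm p m k (fun i => y i - x i).

Definition pk_ball (p : R) (n m : nat) (k : nat -> nat) (x : 'I_n -> R) (r : R)
  : set ('I_n -> R) := [set y | pk_dist p m k x y <= r].

(* \hat Z_S(t) (r plays the role of r_n); a configuration of t points of R^n is
   encoded as a point X of R^(t*n), the i-th point being (fun j => X (i, j)). *)
Definition hatZ (p : R) (n m : nat) (k : nat -> nat) (r : R)
  (S : set ('I_n -> R)) (t : nat) : \bar R :=
  if t is 0 then 1%E else
  ((t`!%:R)^-1)%:E *
  vol [set X : 'I_t * 'I_n -> R |
        (forall i : 'I_t, S (fun j => X (i, j))) /\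
        (forall i i' : 'I_t, i != i' ->
            (2 * r <= pk_dist p m k (fun j => X (i, j)) (fun j => X (i', j)))%R)].

Definition elog (x : \bar R) : \bar R :=
  match x with
  | r%:E => if (0 < r)%R then (ln r)%:E else -oo
  | +oo => +oo
  | -oo => -oo
  end%E.

Definition liminf_pinfty (g : R -> \bar R) : \bar R :=
  ereal_sup [set ereal_inf (g @` [set Rad | M <= Rad]) | M in [set: R]].

Definition entropy_density (p : R) (n m : nat) (k : nat -> nat) (r : R)
  (alpha : R) : \bar R :=
  liminf_pinfty (fun Rad : R =>
    let V := (Rad / r) ^+ n in
    let N := Num.truncn (alpha * V) in
    (((alpha * V)^-1)%:E *
      elog (hatZ p m k r (pk_ball p m k (fun _ : 'I_n => 0%R) Rad) N
              * ((N`!)%:R / V ^+ N)%:E))%E).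

End Defs.

(* Main.v *)
Require Import Defs.
From mathcomp Require Import all_boot all_order all_algebra.
From mathcomp Require Import all_classical all_reals all_analysis.
From mathcomp Require Import measurable_realfun ring lra.

(** We follow the approach of Jenssen, Joos and Perkins, in a discrete form. A fine
    grid turns packings by balls of radius r_n into independent sets of a graph on the
    cells: adjacent cells are those at distance less than about 2 r_n. Degrees are then
    about 2^n over the volume of a cell and, by uniform convexity of the norm, there is
    c < 2 depending only on p such that any set T of neighbours of a cell spans only
    about c^n |T| edges in these units. Take fugacity lam = c^-n / n. Given the
    configuration outside the neighbourhood of a cell v, let T be the set of free
    cells around v: v is free with probability at least e^(-lam |T|), while the mean
    number of points near v is about lam |T|, because T is so sparse at this fugacity.
    Averaging over v and playing the two bounds against each other gives a mean density
    of at least about n log(2/c) / 2^n. Running this for the model truncated at size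
    t + d, where d bounds the degrees, shows that sizes in (t, t + d] carry a positive
    fraction of the weight, hence that there are at least about lam^-t independent sets
    of size t; after normalization this is (c/2)^(n t) up to subexponential factors. *)

Set Implicit Arguments.
Unset Strict Implicit.
Unset Printing Implicit Defensive.

Import Order.TTheory GRing.Theory Num.Theory.
Local Open Scope ring_scope.

(** * The hard-core model on a finite graph *)

Section HardCore.
Import mathcomp.boot.fintype mathcomp.boot.finset.
Variables (R : realType) (V : finType) (e : rel V).
Hypotheses (e_refl : reflexive e) (e_sym : symmetric e).

Definition indep (X : {set V}) :=
  [forall u in X, forall w in X, e u w ==> (u == w)].

(** Since [e] is reflexive this is the closed neighbourhood, so [[disjoint X & nbh v]] already
    excludes [v] from [X]. *)
Definition nbh (v : V) : {set V} := [set u | e v u].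

Lemma indepP (X : {set V}) :
  reflect {in X &, forall u w, e u w -> u = w} (indep X).
Proof.
apply: (iffP idP) => [/forall_inP iX u w uX wX euw|iX].
  by have /forall_inP/(_ w wX) := iX u uX; rewrite euw => /eqP.
apply/forall_inP => u uX; apply/forall_inP => w wX.
by apply/implyP => euw; apply/eqP; exact: iX.
Qed.

Lemma indepS (X Y : {set V}) : Y \subset X -> indep X -> indep Y.
Proof.
move=> /subsetP YX /indepP iX; apply/indepP => u w uY wY.
by apply: iX; exact: YX.
Qed.

Lemma indep0 : indep set0.
Proof. by apply/indepP => u w; rewrite inE. Qed.

Lemma indepU (X Y : {set V}) :
  [disjoint X & Y] ->
  indep (X :|: Y) = [&& indep X, indep Y & [forall u in Y, [disjoint X & nbh u]]].
Proof.
move=> dXY; apply/idP/and3P => [iXY|[/indepP iX /indepP iY /forall_inP dN]].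
  split; [exact: indepS (subsetUl X Y) iXY | exact: indepS (subsetUr X Y) iXY |].
  apply/forall_inP => u uY; rewrite disjoint_subset; apply/subsetP => w wX.
  rewrite !inE; apply/negP => euw.
  have /indepP iXY' := iXY.
  have uw : u = w by apply: iXY' => //; rewrite inE ?uY ?wX ?orbT.
  by move: dXY; rewrite disjoint_subset => /subsetP/(_ w wX); rewrite !inE -uw uY.
have XY u w : u \in X -> w \in Y -> e u w = false.
  move=> uX wY; apply/negP => euw.
  have := dN w wY; rewrite disjoint_subset => /subsetP/(_ u uX).
  by rewrite !inE e_sym euw.
apply/indepP => u w; rewrite !inE => /orP[uX|uY] /orP[wX|wY].
- exact: iX.
- by rewrite XY.
- by rewrite e_sym XY.
- exact: iY.
Qed.

Lemma disjoint_nbh_notin v (X : {set V}) : [disjoint X & nbh v] -> v \notin X.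
Proof.
move=> dX; apply/negP => vX; move: dX.
by rewrite disjoint_subset => /subsetP/(_ v vX); rewrite !inE e_refl.
Qed.

Lemma indepU1 v (X : {set V}) : v \notin X ->
  indep (v |: X) = indep X && [disjoint X & nbh v].
Proof.
move=> vX; rewrite setUC indepU; last by rewrite disjoint_sym disjoints1.
have -> : indep [set v] by apply/indepP => u w /set1P-> /set1P->.
congr (_ && _); apply/forall_inP/idP => [|dX u /set1P->//].
by apply; rewrite set11.
Qed.

Section Fugacity.
Variable lam : R.
Hypothesis lam_gt0 : 0 < lam.

Let wt (X : {set V}) : R := lam ^+ #|X|.

Let wt_ge0 X : 0 <= wt X. Proof. exact/exprn_ge0/ltW. Qed.

(** Removing [v] is a bijection from the independent sets containing [v] onto those avoiding
    [nbh v], at the cost of one factor [lam]. *)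
Lemma sum_indep_insert (P : pred {set V}) v :
  \sum_(X : {set V} | [&& indep X, v \in X & P X]) wt X =
  lam * \sum_(X : {set V} | [&& indep X, [disjoint X & nbh v] & P (v |: X)]) wt X.
Proof.
rewrite (reindex_onto (fun X => v |: X) (fun X => X :\ v)) /=; last first.
  by move=> X /and3P[_ vX _]; rewrite setD1K.
rewrite big_distrr /=.
have E (X : {set V}) : [&& indep (v |: X), v \in v |: X & P (v |: X)] &&
    ((v |: X) :\ v == X) = [&& indep X, [disjoint X & nbh v] & P (v |: X)].
  rewrite setU11 /=; have [vX|vX] := boolP (v \in X).
    have -> : [disjoint X & nbh v] = false.
      by apply/negP => /disjoint_nbh_notin; rewrite vX.
    rewrite andbF; apply/negP => /andP[_ /eqP EX].
    by move: vX; rewrite -EX !inE eqxx.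
  by rewrite setU1K // eqxx andbT indepU1 // andbA.
rewrite (eq_bigl _ _ E); apply: eq_bigr => X /and3P[_ /disjoint_nbh_notin vX _].
by rewrite /wt cardsU1 vX exprS.
Qed.

Definition partition_fun (T : {set V}) : R :=
  \sum_(X : {set V} | indep X && (X \subset T)) lam ^+ #|X|.

Let Z := partition_fun.

Lemma partition_fun_ge0 T : 0 <= Z T.
Proof. apply: sumr_ge0 => X _; exact: wt_ge0. Qed.

(** Dropping independence leaves all subsets of [T], of total weight [(1 + lam) ^+ #|T|]. *)
Lemma partition_fun_le_exp (T : {set V}) : Z T <= expR (lam * #|T|%:R).
Proof.
apply: (@le_trans _ _ ((1 + lam) ^+ #|T|)); last first.
  rewrite mulrC expRM_natl lerXn2r ?nnegrE ?expR_ge0 //.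
    by rewrite addr_ge0 // ltW.
  exact: expR_ge1Dx.
rewrite -prodr_const.
(* When the product is expanded over subsets, the zero outside [T] removes those not contained in
   [T]. *)
have -> : \prod_(i in T) (1 + lam) =
    \prod_i ((if i \in T then lam else 0) + 1).
  rewrite big_mkcond /=; apply: eq_bigr => i _.
  by case: ifP; rewrite ?add0r // addrC.
rewrite bigA_distr /= /Z /partition_fun big_mkcond /=.
apply: ler_sum => X _; case: ifP => [/andP[_ XT]|_]; last first.
  by apply: prodr_ge0 => i _; case: ifP => // _; case: ifP => // _; exact: ltW.
rewrite -prodr_const big_mkcond /= le_eqVlt; apply/orP; left; apply/eqP.
apply: eq_bigr => i _; case: ifP => // iX.
by rewrite (subsetP XT).
Qed.

Lemma occupied_le (T : {set V}) v :
  \sum_(X : {set V} | [&& indep X, v \in X & X \subset T]) wt X <= lam * Z T.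
Proof.
rewrite (sum_indep_insert (fun X => X \subset T)) ler_pM2l //.
rewrite /Z /partition_fun big_mkcond [leRHS]big_mkcond /=.
apply: ler_sum => X _; case: and3P => [[-> _ XT]|_].
  by rewrite /= (subset_trans (subsetUr _ _) XT).
by case: ifP => // _; exact: wt_ge0.
Qed.

(** In the model on [T], a vertex [u] is occupied with probability [lam] times that of [nbh u] being
    empty. By [occupied_le] and a union bound, [nbh u] is hit with probability at most
    [lam * #|T :&: nbh u|]; summing over [u] brings in the average degree bound [K]. *)
Lemma mean_size_ge (T : {set V}) (K : R) :
  \sum_(u in T) #|T :&: nbh u|%:R <= K * #|T|%:R ->
  lam * #|T|%:R * (1 - lam * K) * Z T <=
  \sum_(X : {set V} | indep X && (X \subset T)) #|X|%:R * wt X.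
Proof.
move=> hK.
have -> : \sum_(X : {set V} | indep X && (X \subset T)) #|X|%:R * wt X =
    \sum_(u in T) \sum_(X : {set V} | [&& indep X, u \in X & X \subset T]) wt X.
  transitivity (\sum_(X : {set V} | indep X && (X \subset T))
     \sum_(u in T) (if u \in X then wt X else 0)).
    apply: eq_bigr => X /andP[_ XT].
    rewrite -big_mkcondr /= sumr_const mulr_natl; congr (_ *+ _).
    apply: eq_card => u; rewrite unfold_in /=.
    by apply/idP/andP => [uX|[]//]; split=> //; exact: (subsetP XT).
  rewrite exchange_big /=; apply: eq_bigr => u uT.
  by rewrite -big_mkcondr /=; apply: eq_bigl => X; rewrite -andbA; congr andb; rewrite andbC.
have H u : u \in T -> lam * (Z T - lam * Z T * #|T :&: nbh u|%:R) <=
    \sum_(X : {set V} | [&& indep X, u \in X & X \subset T]) wt X.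
  move=> uT; rewrite (sum_indep_insert (fun X => X \subset T)) ler_pM2l //.
  rewrite lerBlDr.
  have -> : lam * Z T * #|T :&: nbh u|%:R = \sum_(w in T :&: nbh u) lam * Z T.
    by rewrite sumr_const mulr_natr.
  apply: (@le_trans _ _ (\sum_(X : {set V} | [&& indep X, [disjoint X & nbh u] & u |: X \subset T]) wt X +
    \sum_(w in T :&: nbh u) \sum_(X : {set V} | [&& indep X, w \in X & X \subset T]) wt X)); last first.
    by rewrite lerD2l; apply: ler_sum => w _; exact: occupied_le.
  rewrite (eq_bigr (fun w => \sum_(X : {set V} | indep X && (X \subset T)) (if w \in X then wt X else 0))); last first.
    move=> w _; rewrite -big_mkcondr /=; apply: eq_bigl => X.
    by rewrite -andbA; congr andb; rewrite andbC.
  rewrite exchange_big /=.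
  rewrite (eq_bigl (fun X => (indep X && (X \subset T)) && [disjoint X & nbh u])); last first.
    move=> X; rewrite subUset sub1set uT /= -andbA; congr andb.
    by rewrite andbC.
  rewrite big_mkcondr /= -big_split /=.
  apply: ler_sum => X /andP[_ XT]; case: ifP => [_|/negbT].
    by rewrite lerDl; apply: sumr_ge0 => w _; case: ifP.
  rewrite add0r disjoint_subset => /subsetPn[w wX].
  rewrite !inE negbK => euw.
  have wTN : w \in T :&: nbh u by rewrite !inE euw (subsetP XT).
  rewrite (bigD1 w) //= wX lerDl; apply: sumr_ge0 => x _; by case: ifP.
apply: le_trans (ler_sum _ H).
rewrite -big_distrr /= sumrB sumr_const -big_distrr /= -!mulrA ler_pM2l //.
rewrite -mulr_natl.
have : lam * Z T * (\sum_(u in T) #|T :&: nbh u|%:R) <= lam * Z T * (K * #|T|%:R).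
  by apply: ler_wpM2l => //; apply: mulr_ge0; [exact: ltW|exact: partition_fun_ge0].
rewrite -/Z; lra.
Qed.

End Fugacity.

(* Each edge inside [T] is charged to its endpoint of larger rank. *)
Lemma sum_codegree_le (rk : V -> R) (M : R) (T : {set V}) :
  (forall w, w \in T -> #|[set u in T | e u w & rk u <= rk w]|%:R <= M) ->
  \sum_(u in T) #|T :&: nbh u|%:R <= 2 * M * #|T|%:R :> R.
Proof.
move=> hM.
pose f u w : R := (e u w && (rk u <= rk w))%:R.
have cf w : #|[set u in T | e u w & rk u <= rk w]|%:R = \sum_(u in T) f u w.
  rewrite -sum1_card natr_sum big_mkcond [RHS]big_mkcond /=; apply: eq_bigr => u _.
  by rewrite inE /f; case: (u \in T) => //=; case: (e u w && _).
have -> : 2 * M * #|T|%:R = \sum_(w in T) M + \sum_(w in T) M.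
  by rewrite sumr_const -mulr_natr; lra.
apply: (@le_trans _ _ (\sum_(w in T) \sum_(u in T) f u w + \sum_(w in T) \sum_(u in T) f u w)).
  rewrite [X in _ <= X + _]exchange_big /= -big_split /=; apply: ler_sum => u uT.
  rewrite -big_split /= -sum1_card natr_sum (eq_bigl (fun w => (w \in T) && (w \in nbh u))); last first.
    by move=> w; rewrite inE.
  rewrite big_mkcondr /=; apply: ler_sum => w wT; rewrite inE.
  rewrite /f [e w u]e_sym; case: (e u w) ; rewrite /= ?addr0 ?lexx //.
  by case: (leP (rk u) (rk w)) => [_|/ltW ->]; rewrite ?lerDl ?lerDr ?add0r.
by apply: lerD; apply: ler_sum => w wT; rewrite -cf; exact: hM.
Qed.


(** The vertices around [v] still available once the configuration [Y] outside [nbh v] is fixed. *)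
Definition unblocked v (Y : {set V}) : {set V} :=
  [set u in nbh v | [disjoint Y & nbh u]].

(** Spatial Markov property: given [Y] outside [nbh v], the part inside is an arbitrary independent
    subset of [unblocked v Y]. It has at most [d] elements, so the size cap [N] is never
    exceeded. *)
Lemma sum_fiber (N d : nat) v (Y : {set V}) (F : {set V} -> R) :
  (#|nbh v| <= d)%N -> indep Y -> [disjoint Y & nbh v] -> (#|Y| + d <= N)%N ->
  \sum_(X | (indep X && (#|X| <= N)%N) && (X :\: nbh v == Y)) F X =
  \sum_(S | indep S && (S \subset unblocked v Y)) F (Y :|: S).
Proof.
move=> hd iY dY hN.
rewrite (reindex_onto (fun S => Y :|: S) (fun X => X :&: nbh v)) /=; last first.
  by move=> X /andP[_ /eqP <-]; rewrite setUC setID.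
apply: eq_bigl => S.
have YN0 : Y :&: nbh v = set0 by apply/eqP; rewrite setI_eq0.
have YDN : Y :\: nbh v = Y by apply/setDidPl.
have [SN|SN] := boolP (S \subset nbh v); last first.
  have -> : (S \subset unblocked v Y) = false.
    apply/negP => SU; case/negP: SN; apply: subset_trans SU _.
    by apply/subsetP => u; rewrite !inE => /andP[].
  rewrite andbF; apply/negP => /andP[_ /eqP SE].
  by case/negP: SN; rewrite -SE subsetIr.
have -> : (Y :|: S) :\: nbh v == Y.
  rewrite setDUl YDN; have -> : S :\: nbh v = set0 by apply/eqP; rewrite setD_eq0.
  by rewrite setU0.
have -> : (Y :|: S) :&: nbh v == S.
  by rewrite setIUl YN0 set0U; apply/eqP/setIidPl.
rewrite !andbT indepU ?iY /=; last by apply: disjointWr dY.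
have -> /= : (#|Y :|: S| <= N)%N.
  apply: leq_trans hN; apply: leq_trans (leq_card_setU _ _) _.
  by rewrite leq_add2l; apply: leq_trans hd; apply: subset_leq_card.
rewrite andbT; congr andb; apply/forall_inP/subsetP => [H u uS|H u uS].
  by rewrite inE (subsetP SN) //= H.
by have := H u uS; rewrite inE => /andP[].
Qed.

(* Independent sets are truncated at size [N], so that a lower bound on the mean
   size forces independent sets of size close to [N]. *)
Section Truncated.
Variables (lam M z : R) (d N : nat) (rk : V -> V -> R).
Hypothesis lam_gt0 : 0 < lam.
Hypothesis card_nbh_le : forall v, (#|nbh v| <= d)%N.
Hypothesis sparse_nbh : forall v w, w \in nbh v ->
  #|[set u in nbh v | e u w & rk v u <= rk v w]|%:R <= M.
(** The factor [1 - lam * K] of [mean_size_ge], with the average degree [K = 2 * M] from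
    [sum_codegree_le]. *)
Let kap := 1 - lam * (2 * M).
Hypothesis kap_gt0 : 0 < kap.

Let wt (X : {set V}) : R := lam ^+ #|X|.
Let wt_ge0 X : 0 <= wt X. Proof. exact/exprn_ge0/ltW. Qed.
Let Om (X : {set V}) := indep X && (#|X| <= N)%N.

(* With [x = lam * #|T|], this is [exp z >= exp x * (1 + z - x)]: the partition
   function of [T] is at most [exp x], and the mean size at least [kap * x]. *)
Lemma local_ineq v (T : {set V}) : T \subset nbh v ->
  (1 + z) * \sum_(S | indep S && (S \subset T)) wt S <=
  expR z + kap^-1 * \sum_(S | indep S && (S \subset T)) #|S|%:R * wt S.
Proof.
move=> TN; set Z := \sum_(S | indep S && (S \subset T)) wt S.
have Z0 : 0 <= Z by apply: sumr_ge0.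
have hZ : Z <= expR (lam * #|T|%:R) by exact: partition_fun_le_exp.
have h2 : lam * #|T|%:R * Z <= kap^-1 * \sum_(S | indep S && (S \subset T)) #|S|%:R * wt S.
  rewrite [leRHS]mulrC ler_pdivlMr //.
  rewrite mulrAC; apply: (@mean_size_ge lam lam_gt0 T (2 * M)).
  apply: (@sum_codegree_le (rk v)) => w wT.
  apply: le_trans (sparse_nbh (subsetP TN _ wT)).
  rewrite ler_nat; apply/subset_leq_card/subsetP => u; rewrite !inE.
  by case/andP => uT ->; rewrite andbT; have := subsetP TN _ uT; rewrite inE.
apply: le_trans (lerD (lexx _) h2).
rewrite -lerBlDr -mulrBl.
have [h|h] := ltP (1 + z - lam * #|T|%:R) 0.
  by apply: le_trans (expR_ge0 z); rewrite mulr_le0_ge0 // ltW.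
apply: (@le_trans _ _ ((1 + (z - lam * #|T|%:R)) * expR (lam * #|T|%:R))).
  by rewrite addrA; apply: ler_wpM2l.
have -> : expR z = expR (z - lam * #|T|%:R) * expR (lam * #|T|%:R).
  by rewrite -expRD subrK.
by apply: ler_wpM2r; rewrite ?expR_ge0 ?expR_ge1Dx.
Qed.

(* Once [X :\: nbh v = Y] is fixed, truncation plays no role as [#|Y| + d <= N],
   and [X :&: nbh v] is a free hard-core configuration on [unblocked v Y]. *)
Lemma vertex_ineq v :
  (1 + z) * \sum_(X | Om X && (#|X :\: nbh v| + d <= N)%N) wt X <=
  expR z * \sum_(Y | [&& indep Y, [disjoint Y & nbh v] & (#|Y| + d <= N)%N]) wt Y
  + kap^-1 * \sum_(X | Om X) #|X :&: nbh v|%:R * wt X.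
Proof.
pose Q (Y : {set V}) := [&& indep Y, [disjoint Y & nbh v] & (#|Y| + d <= N)%N].
have QX X : Om X && (#|X :\: nbh v| + d <= N)%N -> Q (X :\: nbh v).
  case/andP => /andP[iX _] h; rewrite /Q h (indepS _ iX) ?subsetDl //= andbT.
  by rewrite -setI_eq0 setIDAC setDIl setDv setI0.
apply: (@le_trans _ _ (expR z * \sum_(Y | Q Y) wt Y +
   kap^-1 * \sum_(X | Om X && (#|X :\: nbh v| + d <= N)%N) #|X :&: nbh v|%:R * wt X)); last first.
  rewrite lerD2l; apply: ler_wpM2l; first by rewrite invr_ge0 ltW.
  rewrite big_mkcondr /=; apply: ler_sum => X _; case: ifP => // _.
  by apply: mulr_ge0.
rewrite (partition_big _ Q QX) /= [X in kap^-1 * X](partition_big _ Q QX) /=.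
rewrite !big_distrr /= -big_split /=; apply: ler_sum => Y /and3P[iY dY hY].
have E (F : {set V} -> R) :
   \sum_(X | (Om X && (#|X :\: nbh v| + d <= N)%N) && (X :\: nbh v == Y)) F X =
   \sum_(S | indep S && (S \subset unblocked v Y)) F (Y :|: S).
  rewrite -(@sum_fiber N d v Y F (card_nbh_le v)) //; apply: eq_bigl => X.
  rewrite /Om; have [->|] := eqVneq (X :\: nbh v) Y; last by rewrite !andbF.
  by rewrite hY !andbT.
rewrite !E.
have UN : unblocked v Y \subset nbh v.
  by apply/subsetP => u; rewrite !inE => /andP[].
have SN (S : {set V}) : S \subset unblocked v Y -> S \subset nbh v.
  by move=> SU; exact: subset_trans SU UN.
rewrite (eq_bigr (fun S : {set V} => wt Y * wt S)); last first.
  move=> S /andP[_ /SN sS]; rewrite /wt -exprD cardsU; congr (_ ^+ _).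
  suff -> : Y :&: S = set0 by rewrite cards0 subn0.
  by apply/eqP; rewrite setI_eq0; apply: disjointWr dY.
rewrite [X in _ <= _ + _ * X](eq_bigr (fun S : {set V} => wt Y * (#|S|%:R * wt S))); last first.
  move=> S /andP[_ /SN sS]; rewrite /wt.
  have YS0 : Y :&: S = set0 by apply/eqP; rewrite setI_eq0; apply: disjointWr dY.
  have YN0 : Y :&: nbh v = set0 by apply/eqP; rewrite setI_eq0.
  rewrite setIUl YN0 set0U (setIidPl sS) cardsU YS0 cards0 subn0 exprD.
  by rewrite mulrCA.
rewrite -!big_distrr /= mulrCA [expR z * _]mulrC [kap^-1 * _]mulrCA -mulrDr.
by apply: ler_wpM2l; [exact: wt_ge0 | exact: local_ineq UN].
Qed.

(** Sum [vertex_ineq] over all [v]. Inserting [v] into [Y] turns the first term into the occupancy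
    of [v] over [lam], which sums to the mean size; in the second, every occupied vertex is counted
    by at most [d] neighbourhoods. *)
Lemma hard_core_ineq : (0 < d)%N -> 0 <= 1 + z ->
  #|V|%:R * (1 + z) * \sum_(X | Om X && (#|X| + d <= N)%N) wt X <=
  (expR z / lam + d%:R / kap) * \sum_(X | Om X) #|X|%:R * wt X.
Proof.
move=> d0 z0.
have H1 v : (1 + z) * \sum_(X | Om X && (#|X| + d <= N)%N) wt X <=
    expR z / lam * \sum_(X | Om X && (v \in X)) wt X +
    kap^-1 * \sum_(X | Om X) #|X :&: nbh v|%:R * wt X.
  apply: (@le_trans _ _ ((1 + z) * \sum_(X | Om X && (#|X :\: nbh v| + d <= N)%N) wt X)).
    apply: ler_wpM2l => //; rewrite big_mkcondr [leRHS]big_mkcondr /=.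
    apply: ler_sum => X _; case: ifP => [h|_]; last by case: ifP => // _; exact: wt_ge0.
    rewrite ifT //; apply: leq_trans h; rewrite leq_add2r.
    exact/subset_leq_card/subsetDl.
  apply: le_trans (vertex_ineq v) _; rewrite lerD2r -mulrA.
  apply: ler_wpM2l; first exact: expR_ge0.
  rewrite mulrC ler_pdivlMr // mulrC.
  have -> : \sum_(X | Om X && (v \in X)) wt X =
      \sum_(X | [&& indep X, v \in X & (#|X| <= N)%N]) wt X.
    by apply: eq_bigl => X; rewrite /Om -andbA; congr andb; rewrite andbC.
  rewrite (sum_indep_insert _ (fun X : {set V} => #|X| <= N)%N) ler_pM2l //.
  rewrite big_mkcond [leRHS]big_mkcond /=; apply: ler_sum => Y _.
  case: and3P => [[-> dY hY]|_]; last by case: ifP => // _; exact: wt_ge0.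
  (* Adding [v] raises the size by one, which [#|Y| + d <= N] permits because [0 < d]. *)
  rewrite dY /= ifT // cardsU1 (disjoint_nbh_notin dY) add1n.
  by apply: leq_trans hY; rewrite -addn1 leq_add2l.
have -> : #|V|%:R * (1 + z) * \sum_(X | Om X && (#|X| + d <= N)%N) wt X =
  \sum_(v : V) (1 + z) * \sum_(X | Om X && (#|X| + d <= N)%N) wt X.
  by rewrite sumr_const -[RHS]mulr_natl mulrA.
apply: le_trans (ler_sum _ (fun v _ => H1 v)) _.
rewrite big_split /= -!big_distrr /= mulrDl; apply: lerD.
  apply: ler_wpM2l; first by rewrite divr_ge0 ?expR_ge0 // ltW.
  rewrite (eq_bigr (fun v => \sum_(X | Om X) (if v \in X then wt X else 0))); last first.
    by move=> v _; rewrite big_mkcondr.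
  rewrite exchange_big /=; apply: ler_sum => X _.
  by rewrite -big_mkcond /= sumr_const mulr_natl.
rewrite [d%:R / kap]mulrC -mulrA; apply: ler_wpM2l; first by rewrite invr_ge0 ltW.
rewrite exchange_big /= big_distrr /=; apply: ler_sum => X _.
rewrite -big_distrl /= mulrA; apply: ler_wpM2r; first exact: wt_ge0.
rewrite -natr_sum -natrM ler_nat.
have -> : (\sum_(v : V) #|X :&: nbh v| = \sum_(u in X) #|nbh u|)%N.
  rewrite (eq_bigr (fun v => \sum_(u in X) (e v u : nat)))%N; last first.
    move=> v _; rewrite -sum1_card big_mkcond [RHS]big_mkcond /=.
    by apply: eq_bigr => u _; rewrite !inE; case: (u \in X) => //=; case: (e v u).
  rewrite exchange_big /=; apply: eq_bigr => u _.
  rewrite -sum1_card [RHS]big_mkcond /=; apply: eq_bigr => v _.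
  by rewrite inE e_sym; case: (e u v).
apply: leq_trans (leq_sum _ (fun u _ => card_nbh_le u)) _.
by rewrite sum_nat_const mulnC.
Qed.

End Truncated.

Definition num_indep (k : nat) := #|[set X : {set V} | indep X & #|X| == k]|.

(** Delete a vertex and remember which one. The bound is crude, but it is iterated at most [d]
    times, with [d] fixed while the graph grows. *)
Lemma num_indepS k : (num_indep k.+1 <= num_indep k * #|V|)%N.
Proof.
rewrite /num_indep -cardsT -cardsX.
apply: leq_trans (leq_imset_card (fun a : {set V} * V => a.2 |: a.1) _).
apply/subset_leq_card/subsetP => X; rewrite inE => /andP[iX /eqP cX].
have /card_gt0P[v vX] : (0 < #|X|)%N by rewrite cX.
apply/imsetP; exists (X :\ v, v); last by rewrite /= setD1K.
rewrite !inE /= (indepS _ iX) ?subD1set //= andbT.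
by have := cardsD1 v X; rewrite vX cX add1n => -[<-].
Qed.

Lemma num_indep_add k j : (num_indep (k + j) <= num_indep k * #|V| ^ j)%N.
Proof.
elim: j => [|j IH]; first by rewrite addn0 muln1.
rewrite addnS expnSr mulnA; apply: leq_trans (num_indepS _) _.
by rewrite leq_mul2r IH orbT.
Qed.

(** Take the cap [N = t + d]. The mean size is at most [t + d], so [hard_core_ineq] bounds the
    weight of sizes up to [t] by a fraction [1 - eps]. The remaining sizes lie in [(t, t + d]], and
    deleting points reduces each of them to size [t]. *)
Lemma num_indep_ge (lam M z eps : R) (d t : nat) (rk : V -> V -> R) :
  0 < lam -> lam <= 1 -> (0 < d)%N -> (0 < #|V|)%N ->
  (forall v, (#|nbh v| <= d)%N) ->
  (forall v w, w \in nbh v ->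
    #|[set u in nbh v | e u w & rk v u <= rk v w]|%:R <= M) ->
  0 < 1 - lam * (2 * M) -> 0 < 1 + z ->
  (t + d)%:R * (expR z / lam + d%:R / (1 - lam * (2 * M)))
    <= (1 - eps) * (#|V|%:R * (1 + z)) ->
  eps <= d%:R * (num_indep t)%:R * #|V|%:R ^+ d * lam ^+ t.
Proof.
case: d => // d lam0 lam1 d0 V0 hd hM kap0 z0 hyp.
pose Om (X : {set V}) := indep X && (#|X| <= t + d.+1)%N.
pose wt (X : {set V}) : R := lam ^+ #|X|.
have wt0 X : 0 <= wt X by exact/exprn_ge0/ltW.
pose Z := \sum_(X | Om X) wt X.
pose B := \sum_(X | Om X && (t < #|X|)%N) wt X.
have Z1 : 1 <= Z.
  rewrite /Z (bigD1 set0) /=; last by rewrite /Om indep0 cards0.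
  by rewrite {1}/wt cards0 expr0 lerDl; apply: sumr_ge0.
have ZB : \sum_(X | Om X && (#|X| + d.+1 <= t + d.+1)%N) wt X = Z - B.
  apply/eqP; rewrite eq_sym subr_eq; apply/eqP.
  rewrite /Z /B (bigID (fun X : {set V} => #|X| <= t)%N) /=; congr (_ + _).
    by apply: eq_bigl => X; rewrite leq_add2r.
  by apply: eq_bigl => X; rewrite -ltnNge.
have main := @hard_core_ineq lam M z d.+1 (t + d.+1) rk lam0 hd hM kap0 d0 (ltW z0).
rewrite -/Om ZB in main.
have hE : \sum_(X | Om X) #|X|%:R * wt X <= (t + d.+1)%:R * Z.
  rewrite big_distrr /=; apply: ler_sum => X /andP[_ hX].
  by apply: ler_wpM2r => //; rewrite ler_nat.
have a0 : 0 < #|V|%:R * (1 + z) by rewrite mulr_gt0 // ltr0n.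
have hB : eps * Z <= B.
  have c0 : 0 <= expR z / lam + d.+1%:R / (1 - lam * (2 * M)).
    by rewrite addr_ge0 // divr_ge0 ?expR_ge0 // ltW.
  have := le_trans main (ler_wpM2l c0 hE).
  have := ler_wpM2r (le_trans ler01 Z1) hyp.
  set a := #|V|%:R * (1 + z) in a0 *.
  set b := _ + _ / _ in c0 *.
  move=> h1 h2.
  have : a * (Z - B) <= a * ((1 - eps) * Z) by lra.
  by rewrite ler_pM2l //; lra.
have hB2 : B <= d.+1%:R * (num_indep t)%:R * #|V|%:R ^+ d.+1 * lam ^+ t.
  (* Sort by size: [j] is the size minus [t.+1], so [j = 0] stands for the first size above [t]. *)
  have -> : B = \sum_(j < d.+1) \sum_(X | indep X && (#|X| == t + j.+1)%N) wt X.
    rewrite /B (partition_big (fun X : {set V} => inord (#|X| - t.+1) : 'I_d.+1) xpredT) //=.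
    apply: eq_bigr => j _; apply: eq_bigl => X.
    rewrite /Om; case: (indep X) => //=; apply/andP/eqP => [[/andP[h1 h2] /eqP h3]|hX].
      rewrite -h3 inordK; first by rewrite addnS -addSn subnKC.
      by rewrite ltn_subLR // addSn -addnS.
    rewrite hX leq_add2l ltn_ord -addSnnS leq_addr; split=> //.
    by apply/eqP/val_inj; rewrite /= addSn subSS addKn inordK.
  apply: (@le_trans _ _ (\sum_(j < d.+1) (num_indep t)%:R * #|V|%:R ^+ d.+1 * lam ^+ t)); last first.
    by rewrite sumr_const card_ord -[leLHS]mulr_natl !mulrA.
  apply: ler_sum => j _.
  rewrite (eq_bigr (fun _ => lam ^+ (t + j.+1))); last first.
    by move=> X /andP[_ /eqP hX]; rewrite /wt hX.
  rewrite sumr_const -[leLHS]mulr_natl.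
  apply: ler_pM; rewrite ?ler0n ?exprn_ge0 ?(ltW lam0) //.
    have -> : (#|[pred X | indep X && (#|X| == t + j.+1)]| = num_indep (t + j.+1))%N.
      by apply: eq_card => X; rewrite inE.
    rewrite -natrX -natrM ler_nat; apply: leq_trans (num_indep_add _ _) _.
    by rewrite leq_mul2l leq_pexp2l // orbT.
  by apply: ler_wiXn2l; rewrite ?(ltW lam0) // leq_addr.
have e0 : eps <= 0 \/ 0 < eps by case: (leP eps 0); [left|right].
case: e0 => e0; last first.
  apply: le_trans hB2; apply: le_trans hB; rewrite -[leLHS]mulr1.
  by rewrite ler_pM2l.
apply: le_trans e0 _; rewrite !mulr_ge0 ?ler0n ?exprn_ge0 ?ler0n //.
exact: ltW.
Qed.

(** Each independent set of size [t] has [t!] orderings, and ordered tuples are what the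
    configuration integral sees. *)
Lemma card_indep_tuples t :
  (num_indep t * t`! <= #|[set f : {ffun 'I_t -> V} |
      injectiveb f & indep [set f i | i in 'I_t]]|)%N.
Proof.
set F := [set f : {ffun 'I_t -> V} | _ & _].
have -> : #|F| = (\sum_(X : {set V}) \sum_(f in F | [set f i | i in 'I_t] == X) 1)%N.
  rewrite -sum1_card.
  by rewrite (partition_big (fun f : {ffun 'I_t -> V} => [set f i | i in 'I_t]) xpredT).
rewrite /num_indep -sum_nat_const big_mkcond /=; apply: leq_sum => X _.
case: ifP => //; rewrite inE => /andP[iX /eqP cX].
have -> : t`! = (#|X| ^_ #|'I_t|)%N by rewrite cX card_ord ffactnn.
rewrite -card_inj_ffuns_on sum1_card; apply/subset_leq_card/subsetP => f.
rewrite !inE => /andP[fX fi].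
have imX : [set f i | i in 'I_t] = X.
  apply/eqP; rewrite eqEcard; apply/andP; split.
    by apply/subsetP => _ /imsetP[i _ ->]; exact: (ffun_onP fX).
  by rewrite card_imset ?card_ord ?cX //; exact/injectiveP.
by rewrite unfold_in /= inE fi imX eqxx iX.
Qed.

End HardCore.

Local Open Scope classical_set_scope.
Local Open Scope ring_scope.

(** * Uniform convexity of mixed l_p(l_2) norms *)

Section PowR.
Variable R : realType.
Implicit Types (a e p q x y : R).

(** Bernoulli's inequality as weighted AM-GM: [1 + y] and [1], with weights [e] and [1 - e], are
    compared with their mean through [ln z <= z - 1]. *)
Lemma powR_le_affine e y : 0 <= e <= 1 -> -1 <= y -> powR (1 + y) e <= 1 + e * y.
Proof.
move=> /andP[e0 e1]; rewrite le_eqVlt => /predU1P[<-|y1].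
  (* At [y = -1] the base is [0]: [powR 0 e] is [1] for [e = 0] and [0] otherwise. *)
  rewrite subrr mulrN1; have [->|en0] := eqVneq e 0; first by rewrite powRr0 subr0.
  by rewrite powR0 // subr_ge0.
have y0 : 0 < 1 + y by rewrite -ltrBlDl sub0r.
have A0 : 0 < 1 + e * y.
  move: e1; rewrite le_eqVlt => /predU1P[->|e1]; first by rewrite mul1r.
  by have := mulr_ge0 e0 (ltW y0); lra.
have h (z : R) : 0 < z -> ln z <= z - 1.
  by move=> z0; rewrite -{1}(subrKC 1 z) le_ln1Dx // ltrBrDl subrr.
rewrite /powR gt_eqF // -[leRHS]lnK ?posrE // ler_expR.
have h1 := @h _ (divr_gt0 y0 A0).
have h2 := @h _ (divr_gt0 ltr01 A0).
rewrite ln_div ?posrE // in h1; rewrite ln_div ?posrE // ln1 in h2.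
have -> : e * ln (1 + y) = ln (1 + e * y) + (e * (ln (1 + y) - ln (1 + e * y))
    + (1 - e) * (0 - ln (1 + e * y))) by ring.
rewrite gerDl; apply: (@le_trans _ _
   (e * ((1 + y) / (1 + e * y) - 1) + (1 - e) * (1 / (1 + e * y) - 1))).
  by apply: lerD; apply: ler_wpM2l => //; rewrite subr_ge0.
rewrite le_eqVlt; apply/orP; left; apply/eqP; field.
by rewrite gt_eqF.
Qed.

(* Bernoulli's inequality for the exponent [p - 1 <= 1] at [1 / (1 + x)]. *)
Lemma powR_ge_quot p x : 1 < p <= 2 -> -1 <= x <= 1 ->
  (1 + x) ^+ 2 / (1 + (2 - p) * x) <= powR (1 + x) p.
Proof.
move=> /andP[p1 p2] /andP[]; rewrite le_eqVlt => /predU1P[<- _|x1 x1'].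
  by rewrite subrr expr0n mul0r powR_ge0.
have x0 : 0 < 1 + x by rewrite -ltrBlDl sub0r.
have d0 : 0 < 1 + (2 - p) * x by nra.
have h : powR (1 + x)^-1 (p - 1) <= 1 + (p - 1) * ((1 + x)^-1 - 1).
  rewrite -[X in powR X _](subrKC 1); apply: powR_le_affine; first lra.
  by rewrite lerBrDl subrr invr_ge0 ltW.
have e1 : 1 + (p - 1) * ((1 + x)^-1 - 1) = (1 + (2 - p) * x) / (1 + x).
  by field; rewrite gt_eqF.
have e2 : powR (1 + x)^-1 (p - 1) = (powR (1 + x) (p - 1))^-1.
  by rewrite -powR_inv1 ?ltW // -powRrM mulN1r powRN.
rewrite e1 e2 in h.
have h3 : (1 + x) / (1 + (2 - p) * x) <= powR (1 + x) (p - 1).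
  rewrite -[leRHS]invrK -invf_div lef_pV2 ?posrE //.
    by rewrite divr_gt0.
  by rewrite invr_gt0 powR_gt0.
rewrite -(@mulr_powRB1 _ (1 + x) p (ltW x0)); last lra.
by rewrite expr2 -mulrA ler_pM2l.
Qed.

(** Strict convexity of the power, made quantitative: the bounds of [powR_ge_quot] at [x] and [- x]
    add up to a rational function whose excess over twice the claim is a square over a positive
    denominator. *)
Lemma powR_mean_ge p x : 1 < p <= 2 -> -1 <= x <= 1 ->
  1 + (p - 1) ^+ 2 * x ^+ 2 <= (powR (1 + x) p + powR (1 - x) p) / 2.
Proof.
move=> hp hx; have h1 := powR_ge_quot hp hx.
have h2 : (1 - x) ^+ 2 / (1 + (2 - p) * - x) <= powR (1 - x) p.
  by apply: powR_ge_quot => //; lra.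
rewrite ler_pdivlMr //; apply: le_trans (lerD h1 h2).
move: hp hx => /andP[p1 p2] /andP[x1 x2].
have d1 : 0 < 1 + (2 - p) * x by nra.
have d2 : 0 < 1 + (2 - p) * - x by nra.
rewrite -subr_ge0.
have -> : (1 + x) ^+ 2 / (1 + (2 - p) * x) + (1 - x) ^+ 2 / (1 + (2 - p) * - x) -
   (1 + (p - 1) ^+ 2 * x ^+ 2) * 2 =
   2 * ((p - 1) * (2 - p) * x ^+ 2) ^+ 2 / ((1 + (2 - p) * x) * (1 + (2 - p) * - x)).
  by field; rewrite !gt_eqF.
by apply: divr_ge0; [rewrite mulr_ge0 ?sqr_ge0 | exact/ltW/mulr_gt0].
Qed.

(** Minkowski's inequality from convexity of [powR _ q]: with [A] and [B] the two norms,
    [(u + v) / (A + B)] is a convex combination of [u / A] and [v / B]. Allowing any [w] below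
    [u + v] lets a triangle inequality inside the blocks be fed in. *)
Lemma minkowski_sum (J : finType) (P : pred J) (q : R) (u v w : J -> R) :
  1 <= q -> (forall j, 0 <= u j) -> (forall j, 0 <= v j) ->
  (forall j, 0 <= w j <= u j + v j) ->
  powR (\sum_(j | P j) powR (w j) q) q^-1 <=
  powR (\sum_(j | P j) powR (u j) q) q^-1 + powR (\sum_(j | P j) powR (v j) q) q^-1.
Proof.
move=> q1 u0 v0 hw.
have q0 : 0 < q by exact: lt_le_trans q1.
have S0 (f : J -> R) : 0 <= \sum_(j | P j) powR (f j) q.
  by apply: sumr_ge0 => j _; exact: powR_ge0.
apply/ler_addgt0Pl => e2 e20.
(* The slack keeps both normalizing constants positive even when a norm vanishes. *)
pose e := e2 / 2; have e0 : 0 < e by rewrite divr_gt0.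
have normalized (f : J -> R) : (forall j, 0 <= f j) -> exists C : R, [/\ 0 < C,
    C = powR (\sum_(j | P j) powR (f j) q) q^-1 + e &
    \sum_(j | P j) powR (f j / C) q <= 1].
  move=> f0; exists (powR (\sum_(j | P j) powR (f j) q) q^-1 + e).
  set C := _ + e.
  have C0 : 0 < C by rewrite ltr_wpDl ?powR_ge0.
  have hC : powR (\sum_(j | P j) powR (f j) q) q^-1 <= C by rewrite /C lerDl ltW.
  split=> //; move: C C0 hC => C C0 hC.
  rewrite (eq_bigr (fun j => powR (f j) q * powR C^-1 q)); last first.
    by move=> j _; rewrite powRM ?invr_ge0 // ltW.
  have <- : powR C q * powR C^-1 q = 1.
    by rewrite -powRM ?invr_ge0 ?(ltW C0) // divff ?gt_eqF // powR1.
  rewrite -big_distrl /=; apply: ler_wpM2r; first exact: powR_ge0.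
  rewrite -[leLHS]powRr1 // -(mulVf (lt0r_neq0 q0)) powRrM.
  by apply: ge0_ler_powR; rewrite ?nnegrE ?powR_ge0 ?(ltW q0) ?(ltW C0).
have [A [A0 AE hA]] := normalized u u0.
have [B [B0 BE hB]] := normalized v v0.
have AB0 : 0 < A + B by rewrite addr_gt0.
pose s := A / (A + B).
have s0 : 0 <= s by rewrite divr_ge0 ?ltW.
have s1 : s <= 1 by rewrite ler_pdivrMr // mul1r lerDl ltW.
have hj j : powR (w j) q <= powR (A + B) q *
    (s * powR (u j / A) q + (1 - s) * powR (v j / B) q).
  have /andP[w0 wuv] := hw j.
  have uA0 : 0 <= u j / A by rewrite divr_ge0 ?u0 ?(ltW A0).
  have vB0 : 0 <= v j / B by rewrite divr_ge0 ?v0 ?(ltW B0).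
  have s0' : 0 <= 1 - s by rewrite subr_ge0.
  apply: (@le_trans _ _ (powR ((A + B) * (s * (u j / A) + (1 - s) * (v j / B))) q)).
    apply: ge0_ler_powR; rewrite ?nnegrE ?(ltW q0) //.
      apply: mulr_ge0; first exact: ltW.
      exact: addr_ge0 (mulr_ge0 s0 uA0) (mulr_ge0 s0' vB0).
    suff -> : (A + B) * (s * (u j / A) + (1 - s) * (v j / B)) = u j + v j by [].
    by rewrite /s; field; rewrite !gt_eqF.
  rewrite powRM ?(ltW AB0) //; last first.
    exact: addr_ge0 (mulr_ge0 s0 uA0) (mulr_ge0 s0' vB0).
  apply: ler_wpM2l; first exact: powR_ge0.
  apply: (convex_powR q1 (Itv01 s0 s1));
    by rewrite inE /= in_itv /= andbT divr_ge0 // ltW.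
have hsum : \sum_(j | P j) powR (w j) q <= powR (A + B) q.
  apply: le_trans (ler_sum _ (fun j _ => hj j)) _.
  rewrite -big_distrr /= -[leRHS]mulr1; apply: ler_wpM2l; first exact: powR_ge0.
  rewrite big_split /= -!big_distrr /=.
  apply: (@le_trans _ _ (s * 1 + (1 - s) * 1)); last by rewrite !mulr1 subrKC.
  by apply: lerD; apply: ler_wpM2l => //; rewrite subr_ge0.
apply: (@le_trans _ _ (A + B)); last by rewrite AE BE /e addrACA -splitr addrC.
rewrite -[leRHS]powRr1 ?(ltW AB0) // -(divff (lt0r_neq0 q0)) powRrM.
by apply: ge0_ler_powR; rewrite ?nnegrE ?powR_ge0 ?invr_ge0 ?(ltW q0).
Qed.

(* [s], [t], [m] and [d] are the Euclidean norms of two vectors, of their midpoint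
   and of half their difference. *)
Lemma midpoint_powR_le p e (s t m d : R) : 1 < p <= 2 -> 0 < e ->
  0 <= s -> 0 <= t -> 0 <= m -> 0 <= d ->
  m ^+ 2 + d ^+ 2 = (s ^+ 2 + t ^+ 2) / 2 -> m <= (s + t) / 2 ->
  powR m p <= (powR s p + powR t p) / 2 - (p - 1) ^+ 2 * powR e (2 - p) *
     (powR d p - powR e p * ((powR s p + powR t p) / 2)).
Proof.
move=> hp e0 s0 t0 m0 d0 par mst.
have /andP[p1 p2] := hp.
have p0 : 0 < p by lra.
pose c := (s + t) / 2.
(* If [c <= 0] all four lengths vanish; otherwise everything is measured relative to [c]. *)
have [c0|c0] := leP c 0.
  have s00 : s = 0 by rewrite /c in c0; lra.
  have t00 : t = 0 by rewrite /c in c0; lra.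
  have m00 : m = 0 by lra.
  have d00 : d = 0.
    apply/eqP; rewrite -sqrf_eq0; apply/eqP; move: par.
    by rewrite s00 t00 m00 expr0n /=; lra.
  by rewrite s00 t00 m00 d00 powR0 ?gt_eqF // !(addr0, mul0r, mulr0, subr0).
pose x := (s - t) / 2 / c.
have hx : -1 <= x <= 1.
  by rewrite /x ler_pdivlMr // ler_pdivrMr // /c; apply/andP; split; lra.
have cxE : c * x = (s - t) / 2 by rewrite /x mulrC divfK // gt_eqF.
have sE : s = c * (1 + x) by rewrite mulrDr cxE /c; lra.
have tE : t = c * (1 - x) by rewrite mulrBr cxE /c; lra.
have spE : powR s p = powR c p * powR (1 + x) p.
  by rewrite sE powRM ?(ltW c0) //; lra.
have tpE : powR t p = powR c p * powR (1 - x) p.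
  by rewrite tE powRM ?(ltW c0) //; lra.
pose w := 1 - (m / c) ^+ 2.
have mc1 : 0 <= m / c <= 1 by rewrite divr_ge0 ?(ltW c0) // ler_pdivrMr // mul1r.
have mpE : powR m p = powR c p * powR (1 - w) (p / 2).
  have -> : 1 - w = powR (m / c) 2.
    by rewrite -[2]/(2%:R) powR_mulrn; [rewrite /w; ring|lra].
  rewrite -powRrM [2 * _]mulrC divfK ?pnatr_eq0 // -powRM ?(ltW c0) //; last lra.
  by rewrite mulrC divfK // gt_eqF.
have w01 : 0 <= w <= 1 by rewrite /w; nra.
have hw : powR (1 - w) (p / 2) <= 1 - p / 2 * w.
  by rewrite -mulrN; apply: powR_le_affine; lra.
(* The half difference splits: [x] records the gap in length, [w] the gap in direction. The first
   gains [(p - 1) ^+ 2 * x ^+ 2] by [powR_mean_ge], the second [p / 2 * w] by [hw], and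
   [(p - 1) ^+ 2 <= p / 2]. *)
have dE : (d / c) ^+ 2 = x ^+ 2 + w.
  have -> : (d / c) ^+ 2 = ((s ^+ 2 + t ^+ 2) / 2 - m ^+ 2) / c ^+ 2.
    by rewrite -par expr_div_n; congr (_ / _); ring.
  by rewrite /w sE tE; field; rewrite gt_eqF.
have hm := powR_mean_ge hp hx.
have cp0 : 0 < powR c p by exact: powR_gt0.
pose z := d / c.
have z0 : 0 <= z by rewrite divr_ge0 // ltW.
have dpE : powR d p = powR c p * powR z p.
  by rewrite -powRM ?(ltW c0) // /z mulrC divfK // gt_eqF.
(* The exponent 2 is traded for [p], so that the gains of the blocks can be summed to a power of the
   norm; the threshold [e] is the price, since for [z < e] the left side is nonpositive. *)
have hz : powR e (2 - p) * (powR z p - powR e p) <= z ^+ 2.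
  have [ez|ze] := leP e z.
    have z00 : 0 < z by exact: lt_le_trans ez.
    have -> : z ^+ 2 = powR z (2 - p) * powR z p.
      rewrite -powRD; last by apply/implyP => _; rewrite gt_eqF.
      by rewrite subrK -[2]/(2%:R) powR_mulrn.
    apply: ler_pM; rewrite ?powR_ge0 //.
    - by rewrite subr_ge0; apply: ge0_ler_powR; rewrite ?nnegrE ?(ltW p0) ?(ltW e0).
    - by apply: ge0_ler_powR; rewrite ?nnegrE ?(ltW e0) //; lra.
    - by rewrite gerBl powR_ge0.
  apply: le_trans (sqr_ge0 _); rewrite mulr_ge0_le0 ?powR_ge0 // subr_le0.
  by apply: ge0_ler_powR; rewrite ?nnegrE ?(ltW p0) ?(ltW e0) ?(ltW ze).
have e2 : (p - 1) ^+ 2 <= p / 2 by nra.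
rewrite mpE spE tpE dpE.
set M := (powR (1 + x) p + powR (1 - x) p) / 2 in hm.
have -> : (powR c p * powR (1 + x) p + powR c p * powR (1 - x) p) / 2 = powR c p * M.
  by rewrite /M; lra.
have M1 : 1 <= M.
  by apply: le_trans hm; rewrite lerDl mulr_ge0 ?sqr_ge0.
set C := (p - 1) ^+ 2 in hm e2 *.
have C0 : 0 <= C by exact: sqr_ge0.
have E0 := powR_ge0 e (2 - p).
have Ep0 := powR_ge0 e p.
have key : powR (1 - w) (p / 2) <= M - C * powR e (2 - p) * (powR z p - powR e p * M).
  apply: (@le_trans _ _ (M - C * z ^+ 2)).
    apply: (le_trans hw); rewrite /z dE.
    have /andP[w0 _] := w01.
    have : C * w <= p / 2 * w by exact: ler_wpM2r.
    lra.
  rewrite lerD2l lerN2 -mulrA; apply: ler_wpM2l => //; apply: le_trans hz.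
  by apply: ler_wpM2l => //; rewrite lerD2l lerN2 ler_peMr.
have := ler_wpM2l (ltW cp0) key; lra.
Qed.

End PowR.

(** * The mixed norm: triangle inequality, homogeneity, comparison with coordinates, midpoints *)

Section PkNorm.
Variables (R : realType) (p : R).
Hypothesis hp : 1 < p <= 2.
Variables (n m : nat) (k : nat -> nat).
Implicit Types (x y : 'I_n -> R) (j : nat).

Let p0 : 0 < p. Proof. by have /andP[p1 _] := hp; lra. Qed.

Local Notation N := (@pk_norm R p n m k).
Local Notation beta := (@block_norm R n k).

Let block_norm_ge0 x j : 0 <= beta x j. Proof. exact: sqrtr_ge0. Qed.

Lemma sqr_block_norm x j :
  beta x j ^+ 2 = \sum_(i < n | (k j <= i < k j.+1)%N) x i ^+ 2.
Proof. by rewrite sqr_sqrtr //; apply: sumr_ge0 => i _; exact: sqr_ge0. Qed.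

Lemma block_norm_triangle x y j :
  beta (fun i => x i + y i) j <= beta x j + beta y j.
Proof.
have E z : beta z j =
    powR (\sum_(i < n | (k j <= i < k j.+1)%N) powR `|z i| 2) 2^-1.
  rewrite powR12_sqrt; last by apply: sumr_ge0 => i _; exact: powR_ge0.
  congr Num.sqrt; apply: eq_bigr => i _.
  by rewrite -[2]/(2%:R) powR_mulrn // real_normK // num_real.
rewrite !E; apply: (@minkowski_sum R _ _ 2 (fun i => `|x i|) (fun i => `|y i|)) => //.
- by rewrite ler1n.
- by move=> i; rewrite normr_ge0 ler_normD.
Qed.

Lemma block_normZ (a : R) x j : beta (fun i => a * x i) j = `|a| * beta x j.
Proof.
rewrite /block_norm (eq_bigr (fun i => a ^+ 2 * x i ^+ 2)); last first.
  by move=> i _; rewrite exprMn.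
by rewrite -big_distrr /= sqrtrM ?sqr_ge0 // sqrtr_sqr.
Qed.

Lemma le_block_norm x y j : (forall i, `|x i| <= `|y i|) -> beta x j <= beta y j.
Proof.
move=> xy; rewrite ler_sqrt; last by apply: sumr_ge0 => i _; exact: sqr_ge0.
apply: ler_sum => i _; rewrite -[x i ^+ 2]real_normK ?num_real //.
by rewrite -[y i ^+ 2]real_normK ?num_real // lerXn2r ?nnegrE.
Qed.

Lemma pk_norm_ge0 x : 0 <= N x. Proof. exact: powR_ge0. Qed.

Lemma powR_pk_norm x : powR (N x) p = \sum_(j < m) powR (beta x j) p.
Proof.
rewrite /pk_norm -powRrM mulVf ?gt_eqF // powRr1 //.
by apply: sumr_ge0 => j _; exact: powR_ge0.
Qed.

Lemma pk_norm_le x (a : R) : 0 <= a ->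
  \sum_(j < m) powR (beta x j) p <= powR a p -> N x <= a.
Proof.
move=> a0; rewrite -powR_pk_norm => h; rewrite leNgt; apply/negP => aN.
have := @gt0_ltr_powR R p p0 a (N x); rewrite !nnegrE => /(_ a0 (pk_norm_ge0 x) aN).
by rewrite ltNge h.
Qed.

Lemma pk_norm_triangle x y : N (fun i => x i + y i) <= N x + N y.
Proof.
apply: (@minkowski_sum R 'I_m xpredT p (fun j : 'I_m => beta x j)
  (fun j : 'I_m => beta y j) (fun j : 'I_m => beta (fun i => x i + y i) j)).
- by have /andP[p1 _] := hp; exact: ltW.
- by move=> j; exact: block_norm_ge0.
- by move=> j; exact: block_norm_ge0.
- by move=> j; rewrite block_norm_ge0 block_norm_triangle.
Qed.

Lemma pk_normZ (a : R) x : N (fun i => a * x i) = `|a| * N x.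
Proof.
rewrite /pk_norm (eq_bigr (fun j : 'I_m => powR `|a| p * powR (beta x j) p)); last first.
  by move=> j _; rewrite block_normZ powRM.
rewrite -big_distrr /= powRM ?powR_ge0 //; last first.
  by apply: sumr_ge0 => j _; exact: powR_ge0.
by rewrite -powRrM divff ?gt_eqF // powRr1.
Qed.

Lemma pk_normB x y : N (fun i => x i - y i) = N (fun i => y i - x i).
Proof.
rewrite -[RHS]mul1r -(normrN1 R) -pk_normZ; congr N; apply/funext => i.
by rewrite mulN1r opprB.
Qed.

Lemma le_pk_norm x y : (forall i, `|x i| <= `|y i|) -> N x <= N y.
Proof.
move=> xy; apply: pk_norm_le (pk_norm_ge0 _) _; rewrite powR_pk_norm.
apply: ler_sum => j _; apply: ge0_ler_powR; rewrite ?nnegrE ?block_norm_ge0 ?(ltW p0) //.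
exact: le_block_norm.
Qed.

Lemma pk_norm_le_cst x (h : R) : 0 <= h -> (forall i, `|x i| <= h) ->
  N x <= h * N (fun=> 1).
Proof.
move=> h0 xh; rewrite -{1}(ger0_norm h0) -pk_normZ; apply: le_pk_norm => i.
by rewrite mulr1 (ger0_norm h0).
Qed.

Lemma coord_le_pk_norm x i : k 0%N = 0%N -> k m = n -> `|x i| <= N x.
Proof.
move=> k0 km.
have [j jm hj] : exists2 j, (j < m)%N & (k j <= i < k j.+1)%N.
  have : (i < k m)%N by rewrite km.
  elim: m => [|j IH]; first by rewrite k0.
  move=> ij; have [/IH[j' jj' hj']|hj] := ltnP i (k j).
    by exists j' => //; exact: ltnW.
  by exists j; rewrite // hj.
apply: (@le_trans _ _ (beta x j)).
  rewrite -sqrtr_sqr ler_sqrt; last by apply: sumr_ge0 => ? _; exact: sqr_ge0.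
  by rewrite (bigD1 i) //= lerDl; apply: sumr_ge0 => ? _; exact: sqr_ge0.
rewrite leNgt; apply/negP => h.
have := @gt0_ltr_powR R p p0 (N x) (beta x j).
rewrite !nnegrE => /(_ (pk_norm_ge0 x) (block_norm_ge0 _ _) h).
rewrite ltNge powR_pk_norm (bigD1 (Ordinal jm)) //= lerDl; apply/negP/negPn.
by apply: sumr_ge0 => ? _; exact: powR_ge0.
Qed.

(** Sum [midpoint_powR_le] over the blocks. Its error is proportional to the [p]-th powers of the
    block norms, so the total error is at most [powR e p] however many blocks there are. *)
Lemma pk_norm_midpoint_le (e : R) x y : 0 < e -> N x <= 1 -> N y <= 1 ->
  powR (N (fun i => (x i + y i) / 2)) p <=
  1 - (p - 1) ^+ 2 * powR e (2 - p) *
    (powR (N (fun i => (x i - y i) / 2)) p - powR e p).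
Proof.
have arith (C E X Y D : R) : 0 <= C -> 0 <= E -> X <= 1 -> Y <= 1 ->
    (X + Y) / 2 - C * (D - E * ((X + Y) / 2)) <= 1 - C * (D - E).
  move=> C0 E0 X1 Y1; have : C * (E * ((X + Y) / 2)) <= C * E.
    by apply: ler_wpM2l => //; rewrite ler_piMr //; lra.
  by lra.
move=> e0 Nx Ny.
have le1 z : N z <= 1 -> \sum_(j < m) powR (beta z j) p <= 1.
  move=> Nz; rewrite -powR_pk_norm.
  have <- : powR 1 p = 1 :> R by rewrite powR1.
  by apply: ge0_ler_powR; rewrite ?nnegrE ?pk_norm_ge0 ?(ltW p0).
have hx := le1 _ Nx; have hy := le1 _ Ny.
rewrite [leLHS]powR_pk_norm [X in _ <= _ - _ * (X - _)]powR_pk_norm.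
set X := \sum_(j < m) powR (beta x j) p in hx.
set Y := \sum_(j < m) powR (beta y j) p in hy.
set D := \sum_(j < m) powR (beta (fun i => (x i - y i) / 2) j) p.
set C := (p - 1) ^+ 2 * powR e (2 - p).
have C0 : 0 <= C by rewrite mulr_ge0 ?sqr_ge0 ?powR_ge0.
have Ep0 : 0 <= powR e p by exact: powR_ge0.
apply: (@le_trans _ _ ((X + Y) / 2 - C * (D - powR e p * ((X + Y) / 2)))).
  rewrite /X /Y /D -big_split /= big_distrl /= [powR e p * _]big_distrr /=.
  rewrite -sumrB big_distrr /= -sumrB; apply: ler_sum => j _.
  apply: midpoint_powR_le; rewrite ?block_norm_ge0 //.
    rewrite !sqr_block_norm -!big_split /= big_distrl /=; apply: eq_bigr => i _.
    by field.
  have half z : beta (fun i => z i / 2) j = beta z j / 2.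
    have -> : (fun i => z i / 2) = (fun i => 2^-1 * z i).
      by apply/funext => i; rewrite mulrC.
    by rewrite block_normZ ger0_norm ?invr_ge0 // mulrC.
  by rewrite half ler_pM2r ?invr_gt0 // block_norm_triangle.
exact: arith.
Qed.

End PkNorm.

(** The gain in [pk_norm_midpoint_le] involves only [p] and [e], so one [theta] serves all
    dimensions and blocks. The bound [3 / 4 <= theta] lets the same radius serve points at distance
    below [3 / 4]. *)
Lemma pk_norm_uniformly_convex (R : realType) (p : R) : 1 < p <= 2 ->
  exists2 theta : R, 3 / 4 <= theta < 1 & forall n m k (x y : 'I_n -> R),
    pk_norm p m k x <= 1 -> pk_norm p m k y <= 1 ->
    3 / 4 <= pk_norm p m k (fun i => x i - y i) ->
    pk_norm p m k (fun i => (x i + y i) / 2) <= theta.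
Proof.
move=> hp; have /andP[p1 p2] := hp; have p0 : 0 < p by lra.
have q1 : 3 / 4 < 1 :> R by lra.
have q0 : 0 < 3 / 8 :> R by lra.
have q2 : 3 / 8 = 3 / 4 / 2 :> R by lra.
(* Half the difference has norm at least [3 / 8]; any [e] below that makes the gain [g] positive. *)
pose e : R := 3 / 16.
have e0 : 0 < e by rewrite /e; lra.
pose g : R := (p - 1) ^+ 2 * powR e (2 - p) * (powR (3 / 8) p - powR e p).
have g0 : 0 < g.
  apply: mulr_gt0; last first.
    by rewrite subr_gt0; apply: gt0_ltr_powR => //; rewrite ?nnegrE /e; lra.
  by apply: mulr_gt0; [rewrite exprn_gt0 // subr_gt0 | exact: powR_gt0].
pose t : R := powR (Num.max 0 (1 - g)) p^-1.
have t1 : t < 1.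
  have e1 : powR 1 p^-1 = 1 :> R by rewrite powR1.
  rewrite /t -[ltRHS]e1.
  apply: gt0_ltr_powR; rewrite ?invr_gt0 ?nnegrE ?le_max ?lexx //.
  by rewrite gt_max ltr01 gtrBl.
exists (Num.max (3 / 4) t); first by rewrite le_max lexx gt_max t1 q1.
move=> n m k x y Nx Ny Nxy; rewrite le_max; apply/orP; right.
have := pk_norm_midpoint_le hp e0 Nx Ny.
have half : pk_norm p m k (fun i => (x i - y i) / 2) = pk_norm p m k (fun i => x i - y i) / 2.
  have -> : (fun i => (x i - y i) / 2) = (fun i => 2^-1 * (x i - y i)).
    by apply/funext => i; rewrite mulrC.
  by rewrite pk_normZ // ger0_norm ?invr_ge0 // mulrC.
rewrite half => h.
have h38 : powR (3 / 8) p <= powR (pk_norm p m k (fun i => x i - y i) / 2) p.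
  apply: ge0_ler_powR; rewrite ?nnegrE; [exact: ltW | exact: ltW q0 | |].
    by rewrite divr_ge0 ?pk_norm_ge0.
  by rewrite q2 ler_pM2r ?invr_gt0.
have hg : powR (pk_norm p m k (fun i => (x i + y i) / 2)) p <= Num.max 0 (1 - g).
  rewrite le_max; apply/orP; right; apply: le_trans h _; rewrite lerD2l lerN2.
  by apply: ler_wpM2l; [rewrite mulr_ge0 ?sqr_ge0 ?powR_ge0 | rewrite lerD2r].
have pV0 : 0 <= p^-1 by rewrite invr_ge0 ltW.
have := ge0_ler_powR pV0 _ _ hg; rewrite !nnegrE powR_ge0 le_max lexx.
move=> /(_ isT isT); rewrite -powRrM divff ?lt0r_neq0 //.
by rewrite powRr1 ?pk_norm_ge0.
Qed.

(** * Outer volume of unions of grid cubes *)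

Section Volume.
Variables (R : realType) (I : finType).
Let mu := @lebesgue_measure R.

Section Products.
Variables (W : finType) (p : W -> I -> set R) (g : nat -> I -> set R).
Variables (P : W -> I -> R) (G : nat -> I -> R).
Hypotheses (mp : forall w i, measurable (p w i)) (mg : forall j i, measurable (g j i)).
Hypotheses (pP : forall w i, mu (p w i) = (P w i)%:E).
Hypotheses (gG : forall j i, mu (g j i) = (G j i)%:E).

Let P0 w i : 0 <= P w i.
Proof. by rewrite -lee_fin -pP measure_ge0. Qed.

Let G0 j i : 0 <= G j i.
Proof. by rewrite -lee_fin -gG measure_ge0. Qed.

(* The coordinates in [s] have been integrated out. *)
Let mixed (A : I -> set R) (B : I -> R) (s : seq I) (x : I -> R) : R :=
  \prod_i (if i \in s then B i else \1_(A i) (x i)).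

Let mixed_ge0 A B s x : (forall i, 0 <= B i) -> 0 <= mixed A B s x.
Proof.
by move=> B0; apply: prodr_ge0 => i _; case: ifP => // _; rewrite indicE.
Qed.

Let mixed_cons A B s x i0 : i0 \notin s ->
  mixed A B (i0 :: s) x =
  (\prod_(i | i != i0) (if i \in s then B i else \1_(A i) (x i))) * B i0.
Proof.
move=> i0s; rewrite /mixed (bigD1 i0) //= inE eqxx /= mulrC; congr (_ * _).
by apply: eq_bigr => i ii0; rewrite inE (negbTE ii0).
Qed.

Let mixed_upd A B s x i0 y : i0 \notin s ->
  mixed A B s (fun i => if i == i0 then y else x i) =
  (\prod_(i | i != i0) (if i \in s then B i else \1_(A i) (x i))) * \1_(A i0) y.
Proof.
move=> i0s; rewrite /mixed (bigD1 i0) //= (negbTE i0s) eqxx mulrC; congr (_ * _).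
by apply: eq_bigr => i ii0; rewrite (negbTE ii0).
Qed.

Let mixed_int (A : I -> set R) B s (x : I -> R) i0 : i0 \notin s -> (forall i, 0 <= B i) ->
  measurable (A i0) -> mu (A i0) = (B i0)%:E ->
  (\int[mu]_y (mixed A B s (fun i => if i == i0 then y else x i))%:E =
   (mixed A B (i0 :: s) x)%:E)%E.
Proof.
move=> i0s B0 mA muA; rewrite mixed_cons //.
under eq_integral do rewrite mixed_upd // EFinM.
rewrite ge0_integralZl_EFin //=.
- by rewrite integral_indic // setIT EFinM; congr (_ * _)%E; exact: muA.
- exact/measurable_EFinP/measurable_indic.
- by apply: prodr_ge0 => i _; case: ifP => // _; rewrite indicE.
Qed.

Let mixed_measurable (A : I -> set R) B s (x : I -> R) i0 : i0 \notin s ->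
  measurable (A i0) ->
  measurable_fun [set: measurableTypeR R]
    (fun y : R => (mixed A B s (fun i => if i == i0 then y else x i))%:E).
Proof.
move=> i0s mA; under eq_fun do rewrite mixed_upd //.
by apply/measurable_EFinP/measurable_funM => //; exact: measurable_indic.
Qed.

(** The pointwise inequality is integrated one coordinate at a time against one-dimensional Lebesgue
    measure; nonnegativity lets sums and integrals be exchanged. *)
Lemma sum_prod_le_of_indic :
  (forall x : I -> R, (\sum_w (\prod_i \1_(p w i) (x i) : R)%:E <=
     \sum_(0 <= j <oo) (\prod_i \1_(g j i) (x i) : R)%:E)%E) ->
  (\sum_w (\prod_i P w i)%:E <= \sum_(0 <= j <oo) (\prod_i G j i)%:E)%E.
Proof.
move=> H.
have K s : uniq s -> forall x, (\sum_w (mixed (p w) (P w) s x)%:E <=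
    \sum_(0 <= j <oo) (mixed (g j) (G j) s x)%:E)%E.
  elim: s => [|i0 s IH].
    by move=> _ x; exact: (H x).
  rewrite cons_uniq => /andP[i0s /IH {}IH] x.
  have := @ge0_le_integral _ _ _ mu setT measurableT
    (fun y => \sum_w (mixed (p w) (P w) s (fun i => if i == i0 then y else x i))%:E)%E
    (fun y => \sum_(0 <= j <oo) (mixed (g j) (G j) s (fun i => if i == i0 then y else x i))%:E)%E.
  rewrite ge0_integral_sum //; last first.
  - by move=> w y _; rewrite lee_fin mixed_ge0.
  - by move=> w; exact: mixed_measurable.
  rewrite integral_nneseries //; last first.
  - by move=> j y _; rewrite lee_fin mixed_ge0.
  - by move=> j; exact: mixed_measurable.
  rewrite (eq_bigr (fun w => (mixed (p w) (P w) (i0 :: s) x)%:E)); last first.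
    by move=> w _; exact: mixed_int.
  rewrite (eq_eseriesr (g := fun j => (mixed (g j) (G j) (i0 :: s) x)%:E)); last first.
    by move=> j _; exact: mixed_int.
  apply.
  - by move=> y _; apply: sume_ge0 => w _; rewrite lee_fin mixed_ge0.
  - by apply: emeasurable_sum => w; exact: mixed_measurable.
  - apply: ge0_emeasurable_sum => [j y _ _|j _]; first by rewrite lee_fin mixed_ge0.
    exact: mixed_measurable.
  - by move=> y _; exact: IH.
(* With every coordinate integrated out, the base point is irrelevant. *)
have := K (enum I) (enum_uniq I) (fun=> 0).
rewrite (eq_bigr (fun w => (\prod_i P w i)%:E)); last first.
  by move=> w _; congr EFin; apply: eq_bigr => i _; rewrite mem_enum.
rewrite (eq_eseriesr (g := fun j => (\prod_i G j i)%:E)) //.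
by move=> j _; congr EFin; apply: eq_bigr => i _; rewrite mem_enum.
Qed.

End Products.

Lemma cbox_vol_ge0 (a b : I -> R) : 0 <= cbox_vol a b.
Proof. by apply: prodr_ge0 => i _; rewrite le_max lexx. Qed.

(** Any cover of [S] by boxes covers the cubes of distinct grid positions, so its indicators add up
    to at least theirs; then [sum_prod_le_of_indic] compares the volumes. *)
Lemma vol_grid_ge (W : finType) (f : W -> I -> nat) (b : I -> R) (s : R)
    (S : set (I -> R)) :
  0 < s -> (forall w w', f w =1 f w' -> w = w') ->
  (forall w, cbox (fun i => b i + s * (f w i)%:R) (fun i => b i + s * (f w i).+1%:R)
     `<=` S) ->
  ((#|W|%:R * s ^+ #|I|)%:E <= vol S)%E.
Proof.
move=> s0 finj fS; apply: le_ereal_inf_tmp => _ [ab Scov <-].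
(* Half-open sides make cubes with different indices disjoint, though the closed ones may share
   faces. *)
pose p w i : set R := [set` `[b i + s * (f w i)%:R, b i + s * (f w i).+1%:R[].
pose g j i : set R := [set` `[ab.1 j i, ab.2 j i]].
have -> : (#|W|%:R * s ^+ #|I|)%:E = (\sum_(w : W) (\prod_(i : I) s)%:E)%E.
  by rewrite sumEFin sumr_const prodr_const mulr_natl.
apply: (@sum_prod_le_of_indic W p g (fun _ _ => s) (fun j i => Num.max 0 (ab.2 j i - ab.1 j i))).
- by move=> w i; exact: measurable_itv.
- by move=> j i; exact: measurable_itv.
- move=> w i; rewrite /mu /p lebesgue_measure_itv /= lte_fin ltrD2l ltr_pM2l //.
  rewrite ltr_nat ltnSn -EFinD; congr EFin.
  by rewrite -natr1; ring.
- move=> j i; rewrite /mu /g lebesgue_measure_itv /= lte_fin -EFinD.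
  case: ifPn => h; congr EFin; first by rewrite max_r // subr_ge0 ltW.
  by rewrite max_l // subr_le0 leNgt.
move=> x.
have prod_indic (A : I -> set R) : \prod_i (\1_(A i) (x i) : R) = \1_[set y : I -> R | forall i, A i (y i)] x.
  rewrite [RHS]indicE; case: (boolP (x \in _)) => [|].
    by rewrite inE /= => h; rewrite big1 // => i _; rewrite indicE mem_set.
  move=> /negP xA; have [i hi] : exists i, ~ A i (x i).
    by apply/existsNP => h; apply: xA; rewrite inE.
  by rewrite (bigD1 i) //= indicE memNset // mul0r.
have [[w0 hw0]|nw] := pselect (exists w, forall i, p w i (x i)); last first.
  rewrite big1; first by apply: nneseries_ge0 => j _ _; rewrite lee_fin prod_indic indicE.
  move=> w _; rewrite prod_indic indicE memNset //= => h; apply: nw.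
  by exists w.
rewrite (bigD1 w0) //= [X in (_ + X)%E]big1 ?adde0; last first.
  move=> w ww0; rewrite prod_indic indicE memNset //= => h.
  move/eqP: ww0; apply; apply: finj => i.
  have := h i; have := hw0 i; rewrite /p /= !in_itv /=.
  move=> /andP[h1 h2] /andP[h3 h4].
  have q1 := le_lt_trans h1 h4; have q2 := le_lt_trans h3 h2.
  move: q1 q2; rewrite !ltrD2l !ltr_pM2l // !ltr_nat !ltnS => q1 q2.
  by apply/eqP; rewrite eqn_leq q1 q2.
have [j _ hj] : (\bigcup_j cbox (ab.1 j) (ab.2 j)) x.
  apply: Scov; apply: (fS w0) => i; have := hw0 i; rewrite /p /= in_itv /=.
  by move=> /andP[-> /ltW ->].
apply: le_trans (nneseries_lim_ge j.+1 _); last first.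
  by move=> k _ _; rewrite lee_fin prod_indic indicE.
rewrite big_nat_recr //=; apply: (@le_trans _ _ (\prod_i \1_(g j i) (x i) : R)%:E).
  by rewrite !prod_indic !indicE lee_fin (mem_set hw0) mem_set //.
rewrite leeDr //; apply: sume_ge0 => k _.
by rewrite lee_fin prod_indic indicE.
Qed.

Lemma vol_le_cover (i0 : I) (W : finType) (a b : W -> I -> R) (S : set (I -> R)) :
  S `<=` \bigcup_w cbox (a w) (b w) ->
  (vol S <= (\sum_w cbox_vol (a w) (b w))%:E)%E.
Proof.
move=> Scov.
(* The finite family is continued by the empty box with bounds [1] and [0]. Its volume is [0] thanks
   to the coordinate [i0]: an empty product would be [1]. *)
pose ext (c : W -> I -> R) (d : R) (j : nat) : I -> R :=
  if insub j is Some k then c (enum_val (k : 'I_#|W|)) else fun=> d.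
apply: ereal_inf_lbound; exists (ext a 1, ext b 0).
  move=> x /Scov[w _ hx]; exists (enum_rank w) => //=.
  by rewrite /ext valK /= enum_rankK.
rewrite /= (nneseries_split 0 #|W|); last by move=> k _; rewrite lee_fin cbox_vol_ge0.
rewrite add0n eseries0 ?adde0; last first.
  move=> k hk _; rewrite /ext insubF; last by apply/negbTE; rewrite -leqNgt.
  congr EFin; rewrite /cbox_vol (bigD1 i0) //= sub0r.
  by rewrite max_l ?mul0r // oppr_le0.
rewrite big_mkord -sumEFin (reindex_onto enum_rank enum_val) /=; last first.
  by move=> k _; exact: enum_valK.
rewrite (eq_bigl xpredT); last by move=> w; rewrite enum_rankK eqxx.
by apply: eq_bigr => w _; rewrite /ext valK enum_rankK.
Qed.

End Volume.

Lemma dist_diff_le (R : realDomainType) (h x y u v : R) :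
  0 <= y - v <= h -> 0 <= x - u <= h -> `|v - u - (y - x)| <= h.
Proof.
move=> /andP[a1 a2] /andP[b1 b2]; rewrite ler_norml; apply/andP; split; lra.
Qed.

(** * Discretization by grid cells *)

Section Grid.
Variables (R : realType) (p : R).
Hypothesis hp : 1 < p <= 2.
Variables (n m : nat) (k : nat -> nat).
Hypotheses (n_gt0 : (0 < n)%N) (k0 : k 0%N = 0%N) (km : k m = n).
Variable r : R.
Hypotheses (r_gt0 : 0 < r) (vol_r : vol (pk_ball p m k (fun _ : 'I_n => 0%R) r) = 1%E).

Local Notation N := (@pk_norm R p n m k).
Local Notation D := (N (fun=> 1)).

Lemma pk_norm1_gt0 : 0 < D.
Proof.
have := coord_le_pk_norm hp (fun _ : 'I_n => 1 : R) (Ordinal n_gt0) k0 km.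
by rewrite normr1; apply: lt_le_trans.
Qed.

Lemma pk_ball0 s (x : 'I_n -> R) :
  pk_ball p m k (fun _ : 'I_n => 0%R) s x = (N x <= s) :> Prop.
Proof.
rewrite /pk_ball /pk_dist /=; congr (is_true (pk_norm p m k _ <= s)).
by apply/funext => i; rewrite subr0.
Qed.

Lemma pk_norm_near (x y : 'I_n -> R) (h : R) : 0 <= h ->
  (forall i, `|y i - x i| <= h) -> N y <= N x + h * D.
Proof.
move=> h0 xy; have -> : y = (fun i => x i + (y i - x i)).
  by apply/funext => i; rewrite addrC subrK.
apply: le_trans (pk_norm_triangle hp m k _ _) _; rewrite lerD2l.
exact: (pk_norm_le_cst hp m k).
Qed.

(** The hypothesis puts whole cubes of side [h] into the ball of radius [rho]; scaling by [r / rho]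
    moves them into the ball of volume 1. *)
Lemma count_ball_le (W : finType) (f : W -> 'I_n -> nat) (b : 'I_n -> R) (h rho : R) :
  0 < h -> 0 < rho -> (forall w w', f w =1 f w' -> w = w') ->
  (forall w, N (fun i => b i + h * (f w i)%:R) + h * D <= rho) ->
  #|W|%:R * h ^+ n <= (rho / r) ^+ n.
Proof.
move=> h0 rho0 finj hf.
pose a := r / rho; have a0 : 0 < a by rewrite divr_gt0.
have s0 : 0 < a * h by rewrite mulr_gt0.
have := @vol_grid_ge R 'I_n W f (fun i => a * b i) (a * h)
  (pk_ball p m k (fun _ : 'I_n => 0%R) r) s0 finj.
rewrite vol_r card_ord lee_fin => H.
have {}H : #|W|%:R * (a * h) ^+ n <= 1.
  apply: H => w x hx; rewrite pk_ball0.
  have -> : r = a * rho by rewrite /a divfK // gt_eqF.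
  apply: le_trans (ler_wpM2l (ltW a0) (hf w)).
  rewrite mulrDr mulrA -{1}(gtr0_norm a0) -(pk_normZ hp m k).
  apply: pk_norm_near; first exact: ltW.
  move=> i; have /andP[h1 h2] := hx i.
  rewrite mulrDr !mulrA ger0_norm ?subr_ge0 // lerBlDl.
  by move: h2; rewrite -natr1 mulrDr mulr1 addrA.
have an0 : 0 < a ^+ n by rewrite exprn_gt0.
rewrite -(ler_pM2l an0) [leLHS]mulrCA -exprMn; apply: (le_trans H).
have ar : a * (rho / r) = 1 by rewrite /a; field; rewrite !gt_eqF.
by rewrite -exprMn ar expr1n.
Qed.

Section Cells.
Variables (h Rad : R) (L : nat).
Hypothesis h_gt0 : 0 < h.

Definition cell_pos (z : {ffun 'I_n -> 'I_(L + L)}) : 'I_n -> R :=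
  fun i => h * ((z i)%:R - L%:R).

(** Moving inside a cube of side [h] changes the norm by at most [h * D], so these cubes lie
    entirely in the ball of radius [Rad]. *)
Definition cell := {z : {ffun 'I_n -> 'I_(L + L)} | N (cell_pos z) + h * D <= Rad}.

Definition cpos (u : cell) : 'I_n -> R := cell_pos (val u).

(** The slack [h * D] ensures that points chosen anywhere in two nonadjacent cells are at distance
    at least [2 * r]. *)
Definition cadj : rel cell :=
  fun u v => N (fun i => cpos u i - cpos v i) < 2 * r + h * D.

(** Neighbours of [u] are ranked by distance from [u]; this is the rank used by
    [sum_codegree_le]. *)
Definition crank (u w : cell) : R := N (fun i => cpos w i - cpos u i).

Lemma cadj_sym : symmetric cadj.
Proof. by move=> u v; rewrite /cadj /= (pk_normB hp m k). Qed.

Let hD_gt0 : 0 < h * D. Proof. by rewrite mulr_gt0 // pk_norm1_gt0. Qed.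

Lemma cadj_refl : reflexive cadj.
Proof.
move=> u; rewrite /cadj /=.
have -> : (fun i => cpos u i - cpos u i) = (fun i => 0 * 0 : R).
  by apply/funext => i; rewrite subrr mul0r.
by rewrite (pk_normZ hp m k) normr0 mul0r addr_gt0 // mulr_gt0.
Qed.

Lemma card_cells_near_le (A : {set cell}) (y : 'I_n -> R) (rho : R) : 0 < rho ->
  (forall u, u \in A -> N (fun i => cpos u i - y i) + h * D <= rho) ->
  #|A|%:R * h ^+ n <= (rho / r) ^+ n.
Proof.
move=> rho0 hA.
pose W := {u : cell | u \in A}.
have -> : #|A| = #|{: W}| by rewrite card_sig; apply: eq_card => u.
apply: (@count_ball_le W (fun w i => val (val w) i) (fun i => - (h * L%:R) - y i)) => //.
  move=> w w' ww'; apply/val_inj/val_inj/ffunP => i; apply: val_inj; exact: ww'.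
move=> w.
have -> : (fun i => - (h * L%:R) - y i + h * (val (val w) i)%:R) =
    (fun i => cpos (val w) i - y i).
  by apply/funext => i; rewrite /cpos /cell_pos; ring.
exact: hA (valP w).
Qed.

Lemma card_cells_le : 0 < Rad -> #|{: cell}|%:R * h ^+ n <= (Rad / r) ^+ n.
Proof.
move=> Rad0; rewrite -cardsT; apply: (@card_cells_near_le _ (fun=> 0)) => // u _.
have -> : (fun i => cpos u i - 0) = cpos u by apply/funext => i; rewrite subr0.
exact: (valP u).
Qed.

Lemma card_nbh_cell_le v :
  #|nbh cadj v|%:R * h ^+ n <= ((2 * r + 2 * (h * D)) / r) ^+ n.
Proof.
apply: (@card_cells_near_le _ (cpos v)).
  by rewrite addr_gt0 // mulr_gt0.
move=> u; rewrite inE cadj_sym /cadj /= => hu.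
have -> : 2 * r + 2 * (h * D) = 2 * r + h * D + h * D by ring.
by rewrite lerD2r ltW.
Qed.

(* If [w] is far from [v] then, by uniform convexity, the cells counted lie near the
   midpoint of [v] and [w]; otherwise they are no farther from [v] than [w] is. *)
Lemma sparse_nbh_cell (theta : R) : 3 / 4 <= theta < 1 ->
  (forall x y : 'I_n -> R, N x <= 1 -> N y <= 1 ->
     3 / 4 <= N (fun i => x i - y i) -> N (fun i => (x i + y i) / 2) <= theta) ->
  forall v w, w \in nbh cadj v ->
  #|[set u in nbh cadj v | cadj u w & crank v u <= crank v w]|%:R * h ^+ n <=
    ((theta * (2 * r + h * D) + h * D) / r) ^+ n.
Proof.
move=> /andP[th1 th2] conv v w _.
pose rho := 2 * r + h * D; rewrite -/rho.
have rho0 : 0 < rho by rewrite addr_gt0 // mulr_gt0.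
have th0 : 0 < theta by apply: lt_le_trans th1; rewrite divr_gt0.
have trho : 0 < theta * rho + h * D by rewrite addr_gt0 // mulr_gt0.
have [far|] := boolP (3 / 4 * rho <= N (fun i => cpos w i - cpos v i)); last first.
  rewrite -ltNge => near; apply: (@card_cells_near_le _ (cpos v)) => // u.
  rewrite !inE => /and3P[_ _ hr]; rewrite lerD2r.
  apply: le_trans hr _; apply: le_trans (ltW near) _.
  by rewrite ler_pM2r.
apply: (@card_cells_near_le _ (fun i => (cpos v i + cpos w i) / 2)) => // u.
rewrite !inE cadj_sym => /and3P[uv uw _]; rewrite lerD2r.
rewrite /cadj -/rho in uv uw.
have scaled x : N (fun i => rho^-1 * x i) = N x / rho.
  by rewrite (pk_normZ hp m k) gtr0_norm ?invr_gt0 // mulrC.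
pose a i := cpos u i - cpos v i; pose b i := cpos u i - cpos w i.
have ha : N (fun i => rho^-1 * a i) <= 1.
  rewrite scaled (ler_pdivrMr _ _ rho0) mul1r; exact: ltW uv.
have hb : N (fun i => rho^-1 * b i) <= 1.
  rewrite scaled (ler_pdivrMr _ _ rho0) mul1r; exact: ltW uw.
have hc : 3 / 4 <= N (fun i => rho^-1 * a i - rho^-1 * b i).
  have -> : (fun i => rho^-1 * a i - rho^-1 * b i) =
      (fun i => rho^-1 * (cpos w i - cpos v i)).
    by apply/funext => i; rewrite /a /b; ring.
  rewrite scaled (ler_pdivlMr _ _ rho0); exact: far.
have := conv _ _ ha hb hc.
have -> : (fun i => (rho^-1 * a i + rho^-1 * b i) / 2) =
    (fun i => rho^-1 * (cpos u i - (cpos v i + cpos w i) / 2)).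
  apply/funext => i; rewrite /a /b -mulrDr -mulrA; congr (_ * _).
  by field.
rewrite scaled (ler_pdivrMr _ _ rho0); exact.
Qed.

(** Rounding coordinates down puts every point of the ball of radius [rho] into a cell, and the cell
    stays within [Rad]. Scaled by [r / rho], the cells cover the ball of volume 1. *)
Lemma card_cells_ge (rho : R) : 0 < rho -> rho + 2 * (h * D) <= Rad ->
  rho / h <= L%:R ->
  (rho / r) ^+ n <= #|{: cell}|%:R * h ^+ n.
Proof.
move=> rho0 hrho hL.
pose a := r / rho; have a0 : 0 < a by rewrite divr_gt0.
have s0 : 0 < a * h by rewrite mulr_gt0.
pose A (u : cell) i := a * cpos u i.
pose B (u : cell) i := a * cpos u i + a * h.
have cover : pk_ball p m k (fun _ : 'I_n => 0%R) r `<=` \bigcup_u cbox (A u) (B u).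
  move=> y; rewrite pk_ball0 => hy.
  pose x i := a^-1 * y i.
  have Nx : N x <= rho.
    rewrite (pk_normZ hp m k) gtr0_norm ?invr_gt0 // ler_pdivrMl //.
    by rewrite /a divfK // gt_eqF.
  have xi i : `|x i| <= rho by apply: le_trans Nx; exact: (coord_le_pk_norm hp).
  have xL i : - L%:R <= x i / h <= L%:R.
    rewrite -ler_norml normrM (gtr0_norm (x := h^-1)) ?invr_gt0 //.
    by apply: le_trans hL; rewrite ler_pM2r ?invr_gt0.
  pose q i : R := x i / h + L%:R.
  have q0 i : 0 <= q i by have /andP[h1 _] := xL i; rewrite -lerBlDr sub0r.
  have q2 i : q i <= (L + L)%:R.
    by have /andP[_ h1] := xL i; rewrite natrD lerD2r.
  have LL : (0 < L + L)%N.
    rewrite lt0n; apply/eqP => LL0; have : 0 < rho / h by rewrite divr_gt0.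
    move/lt_le_trans/(_ hL); rewrite ltr0n lt0n.
    by move/eqP: LL0; rewrite addn_eq0 => /andP[/eqP->].
  (* The cap matters only for [q i = (L + L)%:R]: such a point is put on the upper face of the last
     closed cell. *)
  have zlt i : (minn (Num.truncn (q i)) (L + L).-1 < L + L)%N.
    by rewrite gtn_min (prednK LL) leqnn orbT.
  pose z := [ffun i => Ordinal (zlt i)].
  have zx i : 0 <= x i - cell_pos z i <= h.
    have xE : x i = h * (q i - L%:R) by rewrite /q addrK mulrC divfK // gt_eqF.
    have [t1 t2] : 0 <= q i - (minn (Num.truncn (q i)) (L + L).-1)%:R /\
        q i - (minn (Num.truncn (q i)) (L + L).-1)%:R <= 1.
      have /andP[t1 t2] := truncn_itv (q0 i).
      split; first by rewrite subr_ge0; apply: le_trans t1; rewrite ler_nat geq_minl.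
      rewrite lerBlDl natr1 -minnSS (prednK LL) natr_min le_min.
      by rewrite (ltW t2) q2.
    rewrite /cell_pos ffunE /= xE -mulrBr.
    have -> : q i - L%:R - ((minn (Num.truncn (q i)) (L + L).-1)%:R - L%:R) =
       q i - (minn (Num.truncn (q i)) (L + L).-1)%:R by ring.
    by rewrite mulr_ge0 ?ler_piMr // ltW.
  have zR : N (cell_pos z) + h * D <= Rad.
    apply: le_trans hrho; rewrite mulr2n mulrDl mul1r addrA lerD2r.
    apply: (@le_trans _ _ (N x + h * D)); last by rewrite lerD2r.
    apply: pk_norm_near; first exact: ltW.
    by move=> i; have /andP[h1 h2] := zx i; rewrite distrC ger0_norm.
  exists (exist _ z zR : cell) => // i.
  have /andP[h1 h2] := zx i.
  have yE : y i = a * x i by rewrite /x mulVKf // gt_eqF.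
  rewrite /A /B /cpos /= yE; apply/andP; split.
    by rewrite ler_pM2l // -subr_ge0.
  by rewrite -mulrDr ler_pM2l // -lerBlDl.
have := vol_le_cover (Ordinal n_gt0) cover; rewrite vol_r lee_fin.
rewrite (eq_bigr (fun=> (a * h) ^+ n)); last first.
  move=> u _; rewrite /cbox_vol (eq_bigr (fun=> a * h)).
    by rewrite prodr_const card_ord.
  by move=> i _; rewrite /A /B addrC addKr max_r // ltW.
rewrite sumr_const -[_ *+ _]mulr_natl => H.
have an0 : 0 < a ^+ n by rewrite exprn_gt0.
rewrite -(ler_pM2l an0) [leRHS]mulrCA -!exprMn; apply: le_trans H.
have ar : a * (rho / r) = 1 by rewrite /a; field; rewrite !gt_eqF.
by rewrite ar expr1n.
Qed.

Lemma cpos_cube (u : cell) j (y : R) :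
  - (h * L%:R) + h * (val u j)%:R <= y <= - (h * L%:R) + h * (val u j).+1%:R ->
  0 <= y - cpos u j <= h.
Proof.
rewrite -natr1 /cpos /cell_pos; cbv beta; rewrite mulrBr mulrDr mulr1.
move: (h * L%:R) (h * _) => s t /andP[h1 h2]; lra.
Qed.

(** An ordered tuple of pairwise nonadjacent cells is a cube of volume [h ^+ (t * n)] of admissible
    configurations. Different tuples give different grid cubes, and the orderings cancel
    [1 / t!]. *)
Lemma hatZ_ge t : (0 < t)%N ->
  (((num_indep cadj t)%:R * h ^+ (t * n))%:E <=
     hatZ p m k r (pk_ball p m k (fun _ : 'I_n => 0%R) Rad) t)%E.
Proof.
case: t => // t _; rewrite /hatZ.
set S := [set X | _].
pose F := [set f : {ffun 'I_t.+1 -> cell} |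
   injectiveb f & indep cadj [set f i | i in 'I_t.+1]%SET]%SET.
pose W := {f : {ffun 'I_t.+1 -> cell} | f \in F}.
have cW : (num_indep cadj t.+1 * t.+1`! <= #|{: W}|)%N.
  apply: leq_trans (card_indep_tuples cadj t.+1) _.
  by rewrite card_sig; apply: eq_leq; apply: eq_card.
pose fw (w : W) (ij : 'I_t.+1 * 'I_n) : nat := val (val w ij.1) ij.2.
have := @vol_grid_ge R ('I_t.+1 * 'I_n)%type W fw (fun=> - (h * L%:R)) h S h_gt0.
rewrite card_prod !card_ord => H.
have {}H : ((#|{: W}|%:R * h ^+ (t.+1 * n))%:E <= vol S)%E.
  apply: H => [w w' ww'|w X hX].
    apply/val_inj/ffunP => i; apply/val_inj/ffunP => j; apply: val_inj.
    exact: (ww' (i, j)).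
  have hX' i j : 0 <= X (i, j) - cpos (val w i) j <= h by exact: cpos_cube (hX (i, j)).
  have /andP[wi wind] : injectiveb (val w) && indep cadj [set (val w) i | i in 'I_t.+1]%SET.
    by have := valP w; rewrite inE.
  split=> [i|i i' ii'].
    rewrite pk_ball0; apply: le_trans (valP (val w i)).
    apply: pk_norm_near; first exact: ltW.
    by move=> j; have /andP[h1 h2] := hX' i j; rewrite ger0_norm.
  have nadj : ~~ cadj (val w i') (val w i).
    apply/negP => adj; move/indepP/(_ (val w i') (val w i)): wind.
    rewrite !imset_f // => /(_ isT isT adj) /(injectiveP _ wi) E.
    by rewrite E eqxx in ii'.
  move: nadj; rewrite /cadj /= -leNgt => nadj.
  rewrite -(lerD2r (h * D)); apply: (le_trans nadj).
  apply: pk_norm_near; first exact: ltW.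
  move=> j; have := hX' i j; have := hX' i' j.
  exact: dist_diff_le.
apply: (@le_trans _ _ ((t.+1`!%:R^-1)%:E * (#|{: W}|%:R * h ^+ (t.+1 * n))%:E)%E).
  rewrite -EFinM lee_fin mulrA; apply: ler_wpM2r; first exact/exprn_ge0/ltW.
  rewrite ler_pdivlMl ?ltr0n ?fact_gt0 // mulrC -natrM ler_nat.
  exact: cW.
by apply: lee_wpmul2l => //; rewrite lee_fin invr_ge0.
Qed.

End Cells.
End Grid.

(* The hypothesis on the occupancy needed to apply [num_indep_ge], in the units of a
   grid of cell volume [H], with [x = 1 / (4 n)] and [T = 2 ^ n]. *)
Lemma occupancy_arith (R : realFieldType) (x kap q a z V H P d t G T : R) :
  0 < x -> 4 * x <= 1 -> 0 < kap -> q = 4 * x + kap^-1 -> 0 < z -> 0 < H ->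
  0 < P -> P * H = T -> 0 <= d -> d <= P * (1 + x) -> 0 <= t -> t <= a * V -> 0 < V ->
  a * T * q <= (1 - 4 * x) * z -> (1 - x) * V <= G * H ->
  (P * (1 + x)) ^+ 2 * q * H <= V * (z * x) ->
  (t + d) * (P * (4 * x) + d / kap) <= (1 - x) * (G * (1 + z)).
Proof.
move=> x0 x1 kap0 qE z0 H0 P0 PH d0 dP t0 ta V0 hT hG hV.
have kV : 0 < kap^-1 by rewrite invr_gt0.
have q0 : 0 < q by rewrite qE; lra.
have P1 : 0 < P * (1 + x) by apply: mulr_gt0 => //; lra.
have s1 : P * (4 * x) + d / kap <= P * (1 + x) * q.
  have e1 : d / kap <= P * (1 + x) / kap by rewrite ler_pM2r.
  have e2 : P * (4 * x) <= P * (1 + x) * (4 * x).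
    rewrite ler_pM2r; last lra.
    by rewrite ler_peMr //; lra.
  by rewrite qE mulrDr; exact: lerD.
have s0 : 0 <= P * (4 * x) + d / kap.
  by apply: addr_ge0; [apply: mulr_ge0; lra | apply: mulr_ge0 => //; exact: ltW].
have s2 : (t + d) * (P * (4 * x) + d / kap) <=
    (a * V + P * (1 + x)) * (P * (1 + x) * q).
  by apply: ler_pM => //; [exact: addr_ge0 | exact: lerD].
rewrite -(ler_pM2r H0).
apply: (@le_trans _ _ ((a * V + P * (1 + x)) * (P * (1 + x) * q) * H)).
  by rewrite ler_pM2r.
have -> : (a * V + P * (1 + x)) * (P * (1 + x) * q) * H =
    (a * T * q) * (V * (1 + x)) + (P * (1 + x)) ^+ 2 * q * H by rewrite -PH; ring.
have s3 : (a * T * q) * (V * (1 + x)) <= (1 - 4 * x) * z * (V * (1 + x)).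
  by apply: ler_wpM2r => //; apply: mulr_ge0; lra.
apply: le_trans (lerD s3 hV) _.
have zV : 0 < z * V by exact: mulr_gt0.
(* Up to the factor [z * V] this is [(1 - 4 * x) * (1 + x) + x <= (1 - x) ^+ 2]: the reserve [4 * x]
   pays for the degree error, the term of lower order, the cells lost at the boundary and the
   fraction [eps = x]. *)
have s4 : (1 - 4 * x) * z * (V * (1 + x)) + V * (z * x) <=
    (1 - x) * ((1 - x) * V) * z by nra.
apply: (le_trans s4).
have -> : (1 - x) * (G * (1 + z)) * H = (1 - x) * (G * H) * (1 + z) by ring.
have GH0 : 0 <= (1 - x) * V by apply: mulr_ge0; lra.
have x2 : 0 <= 1 - x by lra.
have s5 : (1 - x) * ((1 - x) * V) <= (1 - x) * (G * H) by exact: ler_wpM2l.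
by apply: ler_pM => //; [exact: mulr_ge0 | exact: ltW | rewrite lerDr].
Qed.

(** Rewrites the count of [num_indep_ge] in terms of volumes, using that the cells fill at most [V].
    The prefactor [x * H ^+ d / d%:R] will not depend on the radius. *)
Lemma weight_arith (R : realFieldType) (x I G lam H V f : R) (d t : nat) :
  0 <= I -> 0 <= G -> 0 < lam -> 0 < H -> 0 < V -> 0 <= f -> (0 < d)%N ->
  G * H <= V -> x <= d%:R * I * G ^+ d * (lam * H) ^+ t ->
  x * H ^+ d / d%:R * f / (V ^+ d * (lam * V) ^+ t) <= I * H ^+ t * (f / V ^+ t).
Proof.
move=> I0 G0 lam0 H0 V0 f0 d0 GH hx.
have dR : 0 < d%:R :> R by rewrite ltr0n.
have lt0 : 0 < lam ^+ t by rewrite exprn_gt0.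
have Vt0 : 0 < V ^+ t by rewrite exprn_gt0.
have Vd0 : 0 < V ^+ d by rewrite exprn_gt0.
have Ht0 : 0 <= H ^+ t by rewrite exprn_ge0 // ltW.
have key : x * H ^+ d <= (I * H ^+ t) * (d%:R * (V ^+ d * lam ^+ t)).
  have h1 : x * H ^+ d <= d%:R * I * G ^+ d * (lam * H) ^+ t * H ^+ d.
    by apply: ler_wpM2r => //; rewrite exprn_ge0 // ltW.
  apply: (le_trans h1).
  have -> : d%:R * I * G ^+ d * (lam * H) ^+ t * H ^+ d =
     (I * H ^+ t) * (d%:R * ((G * H) ^+ d * lam ^+ t)).
    by rewrite !exprMn; ring.
  apply: ler_wpM2l; first exact: mulr_ge0.
  rewrite ler_pM2l // ler_pM2r // lerXn2r // nnegrE; last exact: ltW.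
  by apply: mulr_ge0 => //; exact: ltW.
have -> : x * H ^+ d / d%:R * f / (V ^+ d * (lam * V) ^+ t) =
   x * H ^+ d / (d%:R * (V ^+ d * lam ^+ t)) * (f / V ^+ t).
  by rewrite exprMn; field; rewrite !gt_eqF.
apply: ler_wpM2r; first by rewrite divr_ge0 // ltW.
by rewrite ler_pdivrMr // !mulr_gt0.
Qed.

Lemma bernoulli_le (R : realFieldType) (y : R) (n : nat) : 0 <= y <= 1 ->
  1 - n%:R * y <= (1 - y) ^+ n.
Proof.
move=> /andP[y0 y1]; elim: n => [|n IH]; first by rewrite mul0r subr0 expr0.
rewrite exprS; have y2 : 0 <= 1 - y by rewrite subr_ge0.
apply: le_trans (ler_wpM2l y2 IH).
have ny : 0 <= n%:R * (y * y) by rewrite !mulr_ge0.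
by rewrite -natr1; nra.
Qed.

Lemma expr1D_le (R : realFieldType) (y x : R) (n : nat) : 0 <= y -> 0 < x <= 1 ->
  2 * n%:R * y <= x -> (1 + y) ^+ n <= 1 + x.
Proof.
move=> y0 /andP[x0 x1] hy.
have ind i : (i <= n)%N -> (1 + y) ^+ i <= 1 + 2 * i%:R * y.
  elim: i => [_|i IH hi]; first by rewrite expr0 mulr0 mul0r addr0.
  rewrite exprS; have y1 : 0 <= 1 + y by rewrite addr_ge0.
  apply: le_trans (ler_wpM2l y1 (IH (ltnW hi))) _.
  have h1 : 2 * i%:R * y <= 1.
    apply: le_trans x1; apply: le_trans hy; apply: ler_wpM2r => //.
    by rewrite ler_pM2l // ler_nat ltnW.
  have h2 : y * (2 * i%:R * y) <= y * 1 by apply: ler_wpM2l.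
  by rewrite -natr1; nra.
by apply: le_trans (ind n (leqnn n)) _; rewrite lerD2l.
Qed.

(** * Logarithmic estimates for the normalized partition function *)

Section Logarithms.
Variable R : realType.

(** The lower half of Stirling's formula; the induction step is [(1 + 1/t)^t <= e]. *)
Lemma ln_fact_ge (t : nat) : t%:R * ln t%:R - t%:R <= ln t`!%:R :> R.
Proof.
elim: t => [|t IH]; first by rewrite mul0r subr0 fact0 ln1.
rewrite factS natrM lnM ?posrE ?ltr0n ?fact_gt0 //.
have h : t%:R * (ln t.+1%:R - ln t%:R) <= 1 :> R.
  case: t {IH} => [|t]; first by rewrite mul0r.
  have t0 : 0 < t.+1%:R :> R by rewrite ltr0n.
  rewrite -ln_div ?posrE ?ltr0n // -[t.+2%:R]natr1 mulrDl divff ?gt_eqF // mul1r.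
  have : ln (1 + t.+1%:R^-1) <= t.+1%:R^-1 :> R.
    by apply: le_ln1Dx; apply: lt_trans (ltrN10 _) _; rewrite invr_gt0.
  by move=> /(ler_wpM2l (ltW t0)); rewrite divff // gt_eqF.
move: IH h; rewrite -(natr1 t).
move: (ln t%:R) (ln (t%:R + 1)) (ln t`!%:R) => u v w.
move: (t%:R : R) => tt; lra.
Qed.

Lemma ln_le_linear (b V : R) : 0 < b -> 0 < V -> ln V <= b * V - ln b.
Proof.
move=> b0 V0; have := ln_sublinear (mulr_gt0 b0 V0).
by rewrite lnM ?posrE // => /ltW; rewrite lerBrDl.
Qed.

(** By Stirling, [ln t! - t * ln (lam * V)] is at least [t * (2 - B)]. Since [t >= a * V / 2], the
    surplus [2 * t] is at least [a * V]: one half of that absorbs [d * ln V], the other half the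
    constants. *)
Lemma ln_weight_ge (A lam a B V : R) (d : nat) :
  0 < A -> 0 < lam -> 0 < a -> 0 <= B -> expR (3 - B) <= a / (2 * lam) ->
  2 <= a * V ->
  2 * (- ln A - d%:R * ln (a / (2 * d.+1%:R))) <= a * V ->
  let t := Num.truncn (a * V) in
  0 < A * t`!%:R / (V ^+ d * (lam * V) ^+ t) /\
  - (B * (a * V)) <= ln (A * t`!%:R / (V ^+ d * (lam * V) ^+ t)).
Proof.
move=> A0 lam0 a0 B0 hB aV2 hV t.
have aV0 : 0 < a * V by apply: lt_le_trans aV2; rewrite ltr0n.
have V0 : 0 < V by move: aV0; rewrite pmulr_rgt0.
have /andP[t1 t2] := truncn_itv (ltW aV0); rewrite -/t in t1 t2.
have t3 : a * V / 2 <= t%:R.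
  by move: t2; rewrite -natr1; move: (t%:R : R) (a * V) aV2 => u v; lra.
have t0 : 0 < t%:R :> R by apply: lt_le_trans t3; rewrite divr_gt0.
have f0 : 0 < t`!%:R :> R by rewrite ltr0n fact_gt0.
have lV0 : 0 < lam * V by rewrite mulr_gt0.
have D0 : 0 < V ^+ d * (lam * V) ^+ t by rewrite mulr_gt0 ?exprn_gt0.
split; first by rewrite divr_gt0 // mulr_gt0.
rewrite ln_div ?posrE // ?mulr_gt0 // lnM ?posrE // lnM ?posrE ?exprn_gt0 //.
rewrite !lnXn //.
have h1 := ln_fact_ge t.
(* A slope for [ln_le_linear] small enough that [d] times it is at most [a / 2]; the successor keeps
   it defined for [d = 0]. *)
have b0 : 0 < a / (2 * d.+1%:R) by rewrite divr_gt0 // mulr_gt0.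
have h2 := ln_le_linear b0 V0.
have h3 : 3 - B <= ln t%:R - ln (lam * V).
  rewrite -ln_div ?posrE // -[leLHS]expRK ler_ln ?posrE ?expR_gt0 ?divr_gt0 //.
  apply: (le_trans hB); rewrite ler_pdivlMr //.
  have -> : a / (2 * lam) * (lam * V) = a * V / 2 by field; rewrite gt_eqF.
  exact: t3.
have h4 : d%:R * ln V <= a * V / 2 - d%:R * ln (a / (2 * d.+1%:R)).
  apply: le_trans (ler_wpM2l (ler0n _ d) h2) _.
  rewrite mulrBr lerD2r.
  have -> : d%:R * (a / (2 * d.+1%:R) * V) = a * V / 2 * (d%:R / d.+1%:R).
    by field.
  apply: ler_piMr; first by rewrite divr_ge0 // ltW.
  by rewrite ler_pdivrMr // mul1r ler_nat.
have h5 : t%:R * (3 - B) <= t%:R * (ln t%:R - ln (lam * V)).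
  by apply: ler_wpM2l => //; exact: ltW.
have h6 : t%:R * B <= a * V * B by apply: ler_wpM2r.
rewrite -[ln V *+ d]mulr_natl -[ln (lam * V) *+ t]mulr_natl.
move: h1 h4 h5 h6 hV t3; clear.
move: (a * V) (t%:R : R) (d%:R : R) (ln (a / _)) (ln A) (ln (lam * V)) (ln V)
  (ln t%:R) (ln t`!%:R) => aV tt dd lb lA llV lV lt f.
lra.
Qed.

End Logarithms.

Lemma scaled_radius_le (R : realFieldType) (u t : R) :
  u <= (1 - t) / 2 -> 0 < u -> t < 1 -> t * (2 + u) + u <= 1 + t.
Proof. by move=> h1 h2 h3; nra. Qed.

(** * From independent sets of cells to the weight of packings, for a fixed mesh and growing
    radius *)

Section Packings.
Variables (R : realType) (p theta : R).
Hypotheses (hp : 1 < p <= 2) (htheta : 3 / 4 <= theta < 1).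
Variables (n m : nat) (k : nat -> nat).
Hypotheses (n_ge3 : (2 < n)%N) (k0 : k 0%N = 0%N) (km : k m = n).
Hypothesis conv : forall x y : 'I_n -> R,
  pk_norm p m k x <= 1 -> pk_norm p m k y <= 1 ->
  3 / 4 <= pk_norm p m k (fun i => x i - y i) ->
  pk_norm p m k (fun i => (x i + y i) / 2) <= theta.
Variable r : R.
Hypotheses (r_gt0 : 0 < r) (vol_r : vol (pk_ball p m k (fun _ : 'I_n => 0%R) r) = 1%E).

Let x : R := (4 * n%:R)^-1.
Let kap : R := 1 - 8 * x.

(** [tau * r] will be the slack [h * D] of a cell. The conditions keep degrees within a factor
    [1 + x] of the ideal, keep the codegree radius below [(1 + theta) * r], and give [h <= 1]. *)
Lemma grid_scale_exists (D : R) : 0 < D ->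
  exists tau : R, [/\ 0 < tau, (1 + tau) ^+ n <= 1 + x,
    theta * (2 + tau) + tau <= 1 + theta & tau * r <= D].
Proof.
move=> D0; have /andP[th1 th2] := htheta.
have n0 : 0 < n%:R :> R by rewrite ltr0n (leq_trans _ n_ge3).
have x0 : 0 < x by rewrite invr_gt0 mulr_gt0.
have x1 : x <= 1.
  rewrite /x invf_le1 ?mulr_gt0 //; apply: (@le_trans _ _ n%:R).
    by rewrite ler1n (leq_trans _ n_ge3).
  by rewrite ler_peMl ?ler1n // ltW.
pose a1 := x / (2 * n%:R); pose a2 := (1 - theta) / 2; pose a3 := D / r.
have a10 : 0 < a1 by rewrite divr_gt0 // mulr_gt0.
have a20 : 0 < a2 by rewrite divr_gt0 // subr_gt0.
have a30 : 0 < a3 by rewrite divr_gt0.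
pose tau := Num.min a1 (Num.min a2 a3).
have tau0 : 0 < tau by rewrite !lt_min a10 a20.
have t1 : tau <= a1 by rewrite ge_min lexx.
have t2 : tau <= a2 by rewrite !ge_min lexx orbT.
have t3 : tau <= a3 by rewrite !ge_min lexx !orbT.
exists tau; split=> //.
- apply: expr1D_le; first exact: ltW.
    by rewrite x0 x1.
  by move: t1; rewrite /a1 ler_pdivlMr ?mulr_gt0 // mulrC.
- exact: scaled_radius_le t2 tau0 th2.
- by move: t3; rewrite /a3 ler_pdivlMr.
Qed.

(** The mesh is fixed before the radius, so [A], [V0] and [d] do not depend on [Rad]. The fugacity
    per cell is [lam * H], where [H] is the cell volume; the factors [H] cancel in all densities. *)
Lemma packing_weight_ge (lam z a : R) :
  0 < z -> 0 < lam -> lam <= 1 -> 0 < a ->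
  lam * (1 + theta) ^+ n = 4 * x -> expR z = lam * 2 ^+ n * (4 * x) ->
  a * 2 ^+ n * (4 * x + kap^-1) <= (1 - 4 * x) * z ->
  exists (A V0 : R) (d : nat), 0 < A /\ forall Rad, 0 < Rad ->
    let V := (Rad / r) ^+ n in let t := Num.truncn (a * V) in
    V0 <= V -> (0 < t)%N ->
    ((A * t`!%:R / (V ^+ d * (lam * V) ^+ t))%:E <=
      hatZ p m k r (pk_ball p m k (fun _ : 'I_n => 0%R) Rad) t *
        (t`!%:R / V ^+ t)%:E)%E.
Proof.
move=> z0 lam0 lam1 a0 hlam hz ha.
have /andP[th1 th2] := htheta.
have n_gt0 : (0 < n)%N by exact: leq_trans n_ge3.
have n0 : 0 < n%:R :> R by rewrite ltr0n.
have n3 : 3 <= n%:R :> R by rewrite ler_nat.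
have x0 : 0 < x by rewrite invr_gt0 mulr_gt0.
have xn : 4 * x * n%:R = 1 by rewrite /x; field; rewrite gt_eqF.
have x12 : 12 * x <= 1.
  rewrite -[X in _ <= X]xn mulrAC.
  have -> : 12 * x = 4 * 3 * x by ring.
  by rewrite ler_pM2r // ler_pM2l.
have x4 : 4 * x <= 1.
  by apply: le_trans x12; rewrite ler_pM2r // ler_nat.
have kap0 : 0 < kap.
  rewrite subr_gt0; apply: lt_le_trans x12.
  by rewrite ltr_pM2r // ltr_nat.
set D := pk_norm p m k (fun _ : 'I_n => 1 : R).
have D0 : 0 < D by exact: (pk_norm1_gt0 hp n_gt0 k0 km).
have [tau [tau0 tau1 tau2 tau3]] := grid_scale_exists D0.
pose h := tau * r / D.
have h0 : 0 < h by rewrite divr_gt0 // mulr_gt0.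
have h1 : h <= 1 by rewrite ler_pdivrMr // mul1r.
have hD : h * D = tau * r by rewrite divfK // gt_eqF.
pose H := h ^+ n.
have H0 : 0 < H by rewrite exprn_gt0.
have H1 : H <= 1 by rewrite exprn_ile1 // ltW.
pose P := 2 ^+ n / H.
have P0 : 0 < P by rewrite divr_gt0 // exprn_gt0.
have P1 : 1 <= P.
  rewrite ler_pdivlMr // mul1r; apply: (le_trans H1).
  by rewrite exprn_ege1 // ler1n.
have PH : P * H = 2 ^+ n by rewrite divfK // gt_eqF.
pose B := P * (1 + tau) ^+ n.
have B1 : 1 <= B.
  by rewrite -[leLHS]mulr1 ler_pM // exprn_ege1 // lerDl ltW.
have BP : B <= P * (1 + x) by rewrite ler_pM2l.
pose d := Num.truncn B.
have d0 : (0 < d)%N by rewrite truncn_gt0.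
have dB : d%:R <= B by rewrite truncn_le (le_trans ler01 B1).
pose q := 4 * x + kap^-1.
(* [A] is the prefactor of [weight_arith]. The first threshold makes the term of [occupancy_arith]
   without [a] small against [V], the second makes the boundary layer thin. *)
exists (x * H ^+ d / d%:R), (Num.max ((P * (1 + x)) ^+ 2 * q * H / (z * x))
  ((2 * n%:R * tau / x) ^+ n)), d.
split; first by rewrite divr_gt0 ?ltr0n // mulr_gt0 // exprn_gt0.
move=> Rad Rad0 V t; rewrite ge_max => /andP[hV1 hV2] t0.
have V0 : 0 < V by rewrite exprn_gt0 // divr_gt0.
have Rr0 : 0 < Rad / r by rewrite divr_gt0.
have hRad : 2 * n%:R * tau / x <= Rad / r.
  have hh : 0 <= 2 * n%:R * tau / x.
    by apply/ltW; rewrite divr_gt0 // mulr_gt0 // mulr_gt0.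
  by move: hV2; rewrite ler_pXn2r // ?nnegrE // ltW.
(* The relative width of the boundary layer [2 * h * D]; the cells then fill at least
   [(1 - y) ^+ n >= 1 - x] of the ball. *)
pose y := 2 * tau / (Rad / r).
have y0 : 0 < y by rewrite divr_gt0 // mulr_gt0.
have ny : n%:R * y <= x.
  rewrite /y mulrA ler_pdivrMr // [X in _ <= X]mulrC -ler_pdivrMr //.
  by rewrite mulrCA mulrA.
have y1 : y <= x.
  by apply: le_trans ny; rewrite ler_peMl ?ler1n // ltW.
have x1 : x < 1 by apply: lt_le_trans x12; rewrite ltr_pMl // ltr1n.
pose rho := Rad * (1 - y).
have rho0 : 0 < rho by rewrite mulr_gt0 // subr_gt0 (le_lt_trans y1).
pose L := (Num.truncn (Rad / h)).+1.
pose e := @cadj R p n m k r h Rad L.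
have hrho : rho + 2 * (h * D) <= Rad.
  rewrite hD le_eqVlt; apply/orP; left; apply/eqP.
  by rewrite /rho /y; field; rewrite !gt_eqF.
have hL : rho / h <= L%:R.
  apply: (@le_trans _ _ (Rad / h)).
    by rewrite ler_pM2r ?invr_gt0 // ler_piMr ?(ltW Rad0) // gerBl ltW.
  have /andP[_] := truncn_itv (ltW (divr_gt0 Rad0 h0)); exact: ltW.
have gge : (1 - x) * V <= #|{: cell p n m k h Rad L}|%:R * H.
  apply: le_trans (card_cells_ge hp n_gt0 k0 km r_gt0 vol_r h0 rho0 hrho hL).
  have -> : rho / r = Rad / r * (1 - y) by rewrite /rho mulrAC.
  rewrite exprMn mulrC ler_pM2l //.
  have y01 : 0 <= y <= 1 by rewrite (ltW y0) (le_trans y1 (ltW x1)).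
  by apply: le_trans (bernoulli_le n y01); rewrite lerD2l lerN2.
have gle : #|{: cell p n m k h Rad L}|%:R * H <= V by exact: (card_cells_le hp r_gt0 vol_r L h0 Rad0).
have G0 : (0 < #|{: cell p n m k h Rad L}|)%N.
  rewrite -(ltr0n R) -(pmulr_lgt0 _ H0); apply: lt_le_trans gge.
  by rewrite mulr_gt0 // subr_gt0.
have e_refl : reflexive e by exact: (cadj_refl hp n_gt0 k0 km r_gt0 h0).
have e_sym : symmetric e by exact: (cadj_sym hp).
have hdeg v : (#|nbh e v| <= d)%N.
  rewrite truncn_ge_nat; last exact: le_trans ler01 B1.
  rewrite -(ler_pM2r H0).
  apply: le_trans (card_nbh_cell_le hp n_gt0 k0 km r_gt0 vol_r h0 v) _.
  rewrite -/D hD.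
  have -> : (2 * r + 2 * (tau * r)) / r = 2 * (1 + tau) by field; rewrite gt_eqF.
  by rewrite exprMn -PH /B mulrAC.
have hsparse v w : w \in nbh e v ->
    #|[set u in nbh e v | e u w & crank v u <= crank v w]%SET|%:R <= (1 + theta) ^+ n / H.
  move=> vw; rewrite ler_pdivlMr //.
  apply: le_trans (sparse_nbh_cell hp n_gt0 k0 km r_gt0 vol_r h0 htheta conv vw) _.
  rewrite -/D hD.
  have -> : (theta * (2 * r + tau * r) + tau * r) / r = theta * (2 + tau) + tau.
    by field; rewrite gt_eqF.
  have th0 : 0 < theta by apply: lt_le_trans th1; rewrite divr_gt0.
  have tt0 : 0 <= theta * (2 + tau) + tau.
    by apply/ltW; rewrite addr_gt0 // mulr_gt0 // addr_gt0.
  have tt1 : 0 <= 1 + theta by apply/ltW; rewrite addr_gt0.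
  by rewrite lerXn2r // nnegrE.
have kE : 1 - lam * H * (2 * ((1 + theta) ^+ n / H)) = kap.
  have -> : lam * H * (2 * ((1 + theta) ^+ n / H)) = 2 * (lam * (1 + theta) ^+ n).
    by field; rewrite gt_eqF.
  by rewrite hlam /kap; ring.
have lH0 : 0 < lam * H by rewrite mulr_gt0.
have lH1 : lam * H <= 1 by rewrite mulr_ile1 // ltW.
have V1 : (P * (1 + x)) ^+ 2 * q * H <= V * (z * x).
  by move: hV1; rewrite ler_pdivrMr // mulr_gt0.
have ta : t%:R <= a * V by rewrite truncn_le ltW // mulr_gt0.
have occ := occupancy_arith x0 x4 kap0 (erefl q) z0 H0 P0 PH (ler0n _ d)
  (le_trans dB BP) (ler0n _ t) ta V0 ha gge V1.
have z1 : 0 < 1 + z by rewrite addr_gt0.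
have kE0 : 0 < 1 - lam * H * (2 * ((1 + theta) ^+ n / H)) by rewrite kE.
have main := @num_indep_ge R _ e e_refl e_sym (lam * H) ((1 + theta) ^+ n / H)
  z x d t (@crank R p n m k h Rad L) lH0 lH1 d0 G0 hdeg hsparse kE0 z1.
have {}main : x <= d%:R * (num_indep e t)%:R * #|{: cell p n m k h Rad L}|%:R ^+ d * (lam * H) ^+ t.
  apply: main; rewrite kE hz natrD.
  have -> : lam * 2 ^+ n * (4 * x) / (lam * H) = P * (4 * x).
    by rewrite /P; field; rewrite !gt_eqF.
  exact: occ.
have f0 : 0 <= t`!%:R :> R by exact: ler0n.
have := weight_arith (ler0n _ (num_indep e t)) (ler0n _ #|{: cell p n m k h Rad L}|) lam0 H0 V0 f0 d0 gle main.
rewrite -lee_fin => /le_trans; apply.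
rewrite EFinM; apply: lee_wpmul2r.
  by rewrite lee_fin divr_ge0 // exprn_ge0 // ltW.
have := hatZ_ge hp n m k r Rad L h0 t0.
by rewrite /H -exprM mulnC.
Qed.

End Packings.

Import numFieldNormedType.Exports.

(** * Entropy density *)

Section Entropy.
Variable R : realType.

Lemma elog_ge (q : R) (X : \bar R) : 0 < q -> (q%:E <= X)%E -> ((ln q)%:E <= elog X)%E.
Proof.
move=> q0; case: X => [s|_|] /=; [rewrite lee_fin => qs | exact: leey | by []].
have s0 : 0 < s by exact: lt_le_trans qs.
by rewrite s0 lee_fin ler_ln.
Qed.

Lemma le_liminf_pinfty (g : R -> \bar R) (M : R) (c : \bar R) :
  (forall x, M <= x -> (c <= g x)%E) -> (c <= liminf_pinfty g)%E.
Proof.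
move=> H; apply: le_trans (ereal_sup_ubound _); last by exists M.
by apply: le_ereal_inf_tmp => _ [x /= Mx <-]; exact: H.
Qed.

Lemma entropy_density_ge (p theta : R) (n m : nat) (k : nat -> nat) (r lam z a B : R) :
  1 < p <= 2 -> 3 / 4 <= theta < 1 -> (2 < n)%N -> k 0%N = 0%N -> k m = n ->
  (forall x y : 'I_n -> R,
    pk_norm p m k x <= 1 -> pk_norm p m k y <= 1 ->
    3 / 4 <= pk_norm p m k (fun i => x i - y i) ->
    pk_norm p m k (fun i => (x i + y i) / 2) <= theta) ->
  0 < r -> vol (pk_ball p m k (fun _ : 'I_n => 0%R) r) = 1%E ->
  0 < z -> 0 < lam -> lam <= 1 -> 0 < a ->
  lam * (1 + theta) ^+ n = 4 * (4 * n%:R)^-1 ->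
  expR z = lam * 2 ^+ n * (4 * (4 * n%:R)^-1) ->
  a * 2 ^+ n * (4 * (4 * n%:R)^-1 + (1 - 8 * (4 * n%:R)^-1)^-1) <=
    (1 - 4 * (4 * n%:R)^-1) * z ->
  0 <= B -> expR (3 - B) <= a / (2 * lam) ->
  ((- B)%:E <= entropy_density p n m k r a)%E.
Proof.
move=> hp hth n3 k0 km conv r0 hvol z0 lam0 lam1 a0 hlam hz ha B0 hB.
have [A [V0 [d [A0 H]]]] :=
  packing_weight_ge hp hth n3 k0 km conv r0 hvol z0 lam0 lam1 a0 hlam hz ha.
pose K := 2 * (- ln A - d%:R * ln (a / (2 * d.+1%:R))).
(* The bound [1 <= Rad / r] makes [V >= Rad / r >= M]; the other entries are the thresholds of
   [packing_weight_ge] and [ln_weight_ge]. *)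
pose M := Num.max 1 (Num.max V0 (Num.max (2 / a) (K / a))).
apply: (@le_liminf_pinfty _ (r * M)) => Rad hM.
have M1 : 1 <= M by rewrite le_max lexx.
have s1 : M <= Rad / r by rewrite ler_pdivlMr // mulrC.
have s2 : 1 <= Rad / r by exact: le_trans s1.
have Rad0 : 0 < Rad.
  have : 0 < Rad / r by exact: lt_le_trans s2.
  by rewrite pmulr_lgt0 // invr_gt0.
cbv zeta; set V := (Rad / r) ^+ n.
have MV : M <= V.
  apply: (le_trans s1); rewrite /V -[leLHS]expr1.
  by apply: ler_weXn2l => //; exact: leq_trans n3.
have V0V : V0 <= V by apply: le_trans MV; rewrite !le_max lexx orbT.
have aV2 : 2 <= a * V.
  rewrite mulrC -ler_pdivrMr //; apply: le_trans MV.
  by rewrite !le_max lexx !orbT.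
have KV : K <= a * V.
  rewrite mulrC -ler_pdivrMr //; apply: le_trans MV.
  by rewrite !le_max lexx !orbT.
have aV0 : 0 < a * V by apply: lt_le_trans aV2; rewrite ltr0n.
have [Q0 hQ] := ln_weight_ge A0 lam0 a0 B0 hB aV2 KV.
have t0 : (0 < Num.truncn (a * V))%N.
  by rewrite truncn_gt0; apply: le_trans aV2; rewrite ler1n.
have := elog_ge Q0 (H Rad Rad0 V0V t0) => HQ.
apply: (@le_trans _ _ (((a * V)^-1)%:E * (- (B * (a * V)))%:E)%E).
  rewrite -EFinM lee_fin le_eqVlt; apply/orP; left; apply/eqP.
  by rewrite mulrN mulrCA mulVf ?mulr1 // gt_eqF.
apply: lee_wpmul2l; first by rewrite lee_fin invr_ge0 ltW.
by apply: le_trans HQ; rewrite lee_fin.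
Qed.

(** Because [0^-1 = 0], the normalized logarithm is [0] at every radius. This serves the finitely
    many small dimensions. *)
Lemma entropy_density0 (p : R) (n m : nat) (k : nat -> nat) (r : R) :
  entropy_density p n m k r 0 = 0%E.
Proof.
apply/eqP; rewrite eq_le; apply/andP; split.
  apply: ge_ereal_sup => _ [M _ <-]; apply: ge_ereal_inf.
  exists 0%E; last by [].
  by exists M; [exact: lexx | cbv zeta; rewrite mul0r invr0 mul0e].
by apply: (@le_liminf_pinfty _ 0) => Rad _; cbv zeta; rewrite mul0r invr0 mul0e.
Qed.

End Entropy.

(** * Limit of the density factor *)

Section Asymptotics.
Variables (R : realType) (L : R).

(* With fugacity [lam = c^-n / n] and [z = ln (lam * 2^n / n)], the hard-core
   inequality yields the density [(1 - 1/n) z / (1/n + 1/(1 - 2/n)) / 2^n]; this is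
   its ratio to [L * n / 2^n], where [L = ln (2 / c)]. *)
Definition density_factor (n : nat) : R :=
  (1 - n%:R^-1) * (1 - 2 / L * (n%:R^-1 * ln n%:R)) /
  (n%:R^-1 + (1 - 2 * n%:R^-1)^-1).

Lemma cvg_inv_nat : (n%:R^-1 : R) @[n --> \oo] --> (0 : R).
Proof.
apply/gtr0_cvgV0; last exact: cvgr_idn.
by exists 1%N => // n /= n1; rewrite ltr0n.
Qed.

Lemma cvg_ln_over_nat : (n%:R^-1 * ln n%:R : R) @[n --> \oo] --> (0 : R).
Proof.
apply/cvgrPdist_le => e e0.
have e2 : 0 < e / 2 by rewrite divr_gt0.
near=> n.
have n0 : 0 < n%:R :> R by near: n; exists 1%N => // i /= i1; rewrite ltr0n.
have n1 : 1 <= n%:R :> R by near: n; exists 1%N => // i /= i1; rewrite ler1n.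
have hn : - ln (e / 2) / (e / 2) <= n%:R by near: n; exact: nbhs_infty_ger.
rewrite sub0r normrN ger0_norm; last by rewrite mulr_ge0 ?invr_ge0 ?ler0n ?ln_ge0.
rewrite mulrC ler_pdivrMr //.
apply: le_trans (ln_le_linear e2 n0) _.
have -> : e * n%:R = e / 2 * n%:R + n%:R * (e / 2) by field.
by rewrite lerD2l -ler_pdivrMr.
Unshelve. all: by end_near. Qed.

Lemma cvg_density_factor : density_factor n @[n --> \oo] --> (1 : R).
Proof.
have c1 : (1 - n%:R^-1 : R) @[n --> \oo] --> (1 - 0 : R).
  by apply: cvgB; [exact: cvg_cst | exact: cvg_inv_nat].
have c2 : (1 - 2 / L * (n%:R^-1 * ln n%:R) : R) @[n --> \oo] --> (1 - 2 / L * 0 : R).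
  apply: cvgB; first exact: cvg_cst.
  by apply: cvgM; [exact: cvg_cst | exact: cvg_ln_over_nat].
have c3 : (1 - 2 * n%:R^-1 : R) @[n --> \oo] --> (1 - 2 * 0 : R).
  apply: cvgB; first exact: cvg_cst.
  by apply: cvgM; [exact: cvg_cst | exact: cvg_inv_nat].
have c4 : (n%:R^-1 + (1 - 2 * n%:R^-1)^-1 : R) @[n --> \oo] --> (0 + (1 - 2 * 0)^-1 : R).
  apply: cvgD; first exact: cvg_inv_nat.
  by apply: cvgV => //; rewrite mulr0 subr0 oner_neq0.
have -> : 1 = (1 - 0) * (1 - 2 / L * 0) / (0 + (1 - 2 * 0)^-1) :> R.
  by rewrite !mulr0 !subr0 add0r !mul1r invrK.
apply: cvgM; first exact: cvgM.
by apply: cvgV => //; rewrite mulr0 subr0 invr1 add0r oner_neq0.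
Qed.

End Asymptotics.

(** * Choice of the fugacity, the tilt and the density in dimension [n] *)

Section Fugacity.
Variables (R : realType) (c : R) (n : nat).
Hypotheses (c_ge1 : 1 <= c) (c_lt2 : c < 2) (n_ge3 : (2 < n)%N).

Let L : R := ln (2 / c).
Let lam : R := (c ^+ n * n%:R)^-1.
(** Makes [expR z / lam] equal to [2 ^+ n / n], which is small against the degree term of order
    [2 ^+ n] in [hard_core_ineq]. *)
Let z : R := n%:R * L - 2 * ln n%:R.
Let g : R := density_factor L n.
Let a : R := g * (L * n%:R / 2 ^+ n).

Let c0 : 0 < c. Proof. exact: lt_le_trans c_ge1. Qed.
Let n0 : 0 < n%:R :> R. Proof. by rewrite ltr0n; exact: leq_trans n_ge3. Qed.
Let n1 : 1 <= n%:R :> R. Proof. by rewrite ler1n; exact: leq_trans n_ge3. Qed.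
Let cn0 : 0 < c ^+ n. Proof. by rewrite exprn_gt0. Qed.
Let tn0 : 0 < 2 ^+ n :> R. Proof. by rewrite exprn_gt0. Qed.

Lemma ln_ratio_gt0 : 0 < L.
Proof. by rewrite ln_gt0 // ltr_pdivlMr // mul1r. Qed.

Lemma fugacity_gt0 : 0 < lam.
Proof. by rewrite invr_gt0 mulr_gt0. Qed.

Lemma fugacity_le1 : lam <= 1.
Proof.
rewrite invf_le1 ?mulr_gt0 // -[leLHS]mulr1; apply: ler_pM => //.
exact: exprn_ege1.
Qed.

Lemma fugacity_sparse : lam * c ^+ n = 4 * (4 * n%:R)^-1.
Proof. by rewrite /lam; field; rewrite !gt_eqF. Qed.

Lemma expR_ln_ratio : expR (n%:R * L) = 2 ^+ n / c ^+ n.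
Proof. by rewrite expRM_natl lnK ?posrE ?divr_gt0 // expr_div_n. Qed.

Lemma expR_tilt : expR z = lam * 2 ^+ n * (4 * (4 * n%:R)^-1).
Proof.
rewrite expRD expRN expR_ln_ratio expRM_natl lnK ?posrE //.
by rewrite /lam; field; rewrite !gt_eqF.
Qed.

Let u : R := n%:R^-1.
Let q : R := u + (1 - 2 * u)^-1.

Let u_gt0 : 0 < u. Proof. by rewrite invr_gt0. Qed.

Let u3 : 3 * u <= 1.
Proof. by rewrite ler_pdivrMr // mul1r ler_nat. Qed.

Let u_lt1 : 0 < 1 - 2 * u.
Proof. by have := u3; have := u_gt0; move: u => v; lra. Qed.

Let q_gt0 : 0 < q.
Proof. by rewrite addr_gt0 // invr_gt0. Qed.

Let gE : g = (1 - u) * (1 - 2 / L * (u * ln n%:R)) / q. Proof. by []. Qed.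

Let zE : z = n%:R * L * (1 - 2 / L * (u * ln n%:R)).
Proof.
rewrite /z /u; have := lt0r_neq0 ln_ratio_gt0; move: L (ln n%:R) => s t s0.
by field; rewrite s0 gt_eqF.
Qed.

Lemma tilt_gt0 : 1 / 2 <= g -> 0 < z.
Proof.
move=> g2; have g0 : 0 < g by apply: lt_le_trans g2; rewrite divr_gt0.
have u1 : 0 < 1 - u by have := u3; have := u_gt0; move: u => v; lra.
move: g0; rewrite gE pmulr_lgt0 ?invr_gt0 // pmulr_rgt0 // => h.
by rewrite zE !mulr_gt0 // ln_ratio_gt0.
Qed.

Lemma density_balance :
  a * 2 ^+ n * (4 * (4 * n%:R)^-1 + (1 - 8 * (4 * n%:R)^-1)^-1) =
  (1 - 4 * (4 * n%:R)^-1) * z.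
Proof.
have e4 : 4 * (4 * n%:R)^-1 = u by rewrite /u; field; rewrite gt_eqF.
have e8 : 8 * (4 * n%:R)^-1 = 2 * u by rewrite /u; field; rewrite gt_eqF.
have aE : a * 2 ^+ n = g * (L * n%:R) by rewrite /a; field; rewrite gt_eqF.
rewrite e4 e8 aE zE gE -/q; move: (1 - 2 / L * _) => w.
by field; rewrite gt_eqF.
Qed.

Lemma density_gt0 : 1 / 2 <= g -> 0 < a.
Proof.
move=> g2; have g0 : 0 < g by apply: lt_le_trans g2; rewrite divr_gt0.
by rewrite mulr_gt0 // divr_gt0 // mulr_gt0 // ln_ratio_gt0.
Qed.

(** Both sides carry the factor [(c / 2) ^+ n]. What remains is [expR 3 <= g * L * n^2 / 2]: the
    polynomial factor absorbs the constant, so the entropy bound [L * n] needs no correction. *)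
Lemma density_fugacity_ge : 1 / 2 <= g -> 4 * expR 3 / L <= n%:R ->
  expR (3 - L * n%:R) <= a / (2 * lam).
Proof.
have L0 := ln_ratio_gt0.
move=> g2; rewrite ler_pdivrMr // => nL.
have g0 : 0 < g by apply: lt_le_trans g2; rewrite divr_gt0.
rewrite expRD expRN mulrC [L * _]mulrC expR_ln_ratio invf_div.
have -> : a / (2 * lam) = c ^+ n / 2 ^+ n * (g * (n%:R * L) * n%:R / 2).
  by rewrite /a /lam; field; rewrite !gt_eqF.
rewrite ler_pM2l ?divr_gt0 // ler_pdivlMr //.
have nL0 : 0 < n%:R * L by rewrite mulr_gt0.
apply: (@le_trans _ _ (1 / 2 * (n%:R * L) * 1)).
  rewrite mulr1 div1r mulrC; move: nL.
  by rewrite -[4]/(4%:R) => nL; rewrite ler_pdivlMl // mulrA -natrM.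
apply: ler_pM => //; first by rewrite mulr_ge0 // ltW.
by rewrite ler_pM2r.
Qed.

End Fugacity.

(** * Choice of the constant and of the error sequences *)

Theorem theorem18 (R : realType) (p : R) :
  1 < p <= 2 ->
  exists c : R, 0 < c < 2 /\
  exists eta eta' : nat -> R,
    (eta i @[i --> \oo] --> 0) /\ (eta' i @[i --> \oo] --> 0) /\
    forall (n m : nat) (k : nat -> nat),
      (0 < n)%N -> k 0%N = 0%N -> k m = n ->
      (forall j, (j < m)%N -> (k j < k j.+1)%N) ->
      forall r_n : R, 0 < r_n ->
      vol (pk_ball p m k (fun _ : 'I_n => 0%R) r_n) = 1%E ->
      exists alpha : R,
        alpha = (1 + eta n) * (ln (2 / c) * n%:R / 2 ^+ n) /\
        ((- ((1 + eta' n) * ln (2 / c) * n%:R))%:E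
           <= entropy_density p n m k r_n alpha)%E.
Proof.
move=> hp.
have [theta htheta conv] := pk_norm_uniformly_convex hp.
have /andP[th1 th2] := htheta.
(* Uniform convexity gives codegrees of order [(2 * theta) ^+ n]; as [2 * theta < 1 + theta < 2],
   this [c] leaves room for the discretization error and stays below 2. *)
pose c := 1 + theta.
have th0 : 0 < theta by apply: lt_le_trans th1; rewrite divr_gt0.
have c1 : 1 <= c by rewrite lerDl ltW.
have c0 : 0 < c by exact: lt_le_trans c1.
have c2 : c < 2 by rewrite -[2]/(1 + 1) ltrD2l.
exists c; split; first by rewrite c0 c2.
have L0 := ln_ratio_gt0 c1 c2.
set L := ln (2 / c) in L0 *.
have cvgf := cvg_density_factor L.
have half1 : 1 / 2 < 1 :> R by rewrite ltr_pdivrMr // mul1r ltr1n.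
have near_half := cvgr_ge _ cvgf _ half1.
have [n0 _ hn0] : \forall n \near \oo, [/\ (2 < n)%N, 1 / 2 <= density_factor L n &
    4 * expR 3 / L <= n%:R].
  near=> n; split; near: n.
  - by exists 3%N.
  - exact: near_half.
  - exact: nbhs_infty_ger.
(* Below [n0], which depends on [p] only, the value [-1] makes the density [0], where
   [entropy_density0] applies. *)
pose eta n : R := if (n0 <= n)%N then density_factor L n - 1 else - 1.
exists eta, (fun=> 0); split.
  rewrite -(subrr (1 : R)).
  apply: (@cvg_trans _ ((density_factor L n - 1) @[n --> \oo])).
    apply: near_eq_cvg; exists n0 => // n /= hn.
    by rewrite /eta hn.
  by apply: cvgB => //; exact: cvg_cst.
split; first exact: cvg_cst.
move=> n m k n_gt0 k0 km _ r r0 hvol.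
exists ((1 + eta n) * (L * n%:R / 2 ^+ n)); split=> //.
rewrite addr0 mul1r /eta; case: ifPn => hn; last first.
  by rewrite subrr mul0r entropy_density0 lee_fin oppr_le0 mulr_ge0 // ltW.
have [n3 g2 nL] := hn0 n hn.
rewrite subrKC.
apply: (entropy_density_ge hp htheta n3 k0 km (@conv n m k) r0 hvol
  (tilt_gt0 c1 c2 n3 g2) (fugacity_gt0 c1 n3) (fugacity_le1 c1 n3)
  (density_gt0 c1 c2 n3 g2) (fugacity_sparse c1 n3) (expR_tilt c1 n3)).
- by rewrite (density_balance c1 c2 n3).
- by rewrite mulr_ge0 // ltW.
- exact: (density_fugacity_ge c1 c2 n3 g2 nL).
Unshelve. all: by end_near. Qed.
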